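(* (In $\mathbf{ZF}$.) The following seven statements are all equivalent: - $\mathbf{CAC}$: every denumerable family of non-empty sets has a choice function; - $\mathbf{FU}_M$: every metrizable space is Fréchet-Urysohn; - $\mathbf{S}_M$: every metrizable space is sequential; - $\mathbf{HS}_M$: every subspace of every metrizable space is sequential; - (i) every first-countable Hausdorff space is Fréchet-Urysohn; - (ii) every first-countable Hausdorff space is sequential; - (iii) every first-countable Hausdorff space is hereditarily sequential.
   Context: The result is a theorem of $\mathbf{ZF}$ (Zermelo–Fraenkel set theory without the axiom of choice). A set is denumerable if it is infinite and equipotent with a subset of $\omega$. A set $A\subseteq X$ is sequentially closed in $\mathbf{X}$ if every point of $X$ which is a limit of a sequence of points of $A$ converging in $\mathbf{X}$ belongs to $A$. A space is sequential if its sequentially closed sets are exactly its closed sets; it is hereditarily sequential if all its subspaces are sequential. A space $\mathbf{X}$ is Fréchet-Urysohn if, for every $A\subseteq X$ and every $x$ in the closure of $A$, there is a sequence of points of $A$ converging in $\mathbf{X}$ to $x$. *)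

(* Defs.v *)
From Stdlib Require Import ClassicalEpsilon.

(** * First-order set theory

    "Theorem of ZF" is read as "true in every model of first-order ZF".  The
    ambient logic of Rocq, with or without its choice axioms, does not make
    choice principles true in such a model: a choice function has to be an
    element of the model, and Separation and Replacement are only available
    for first-order formulas. *)

(** Formulas of the language {=, ∈}, in de Bruijn notation. *)
Inductive formula : Type :=
| fMem (i j : nat)
| fEq (i j : nat)
| fNot (p : formula)
| fAnd (p q : formula)
| fOr (p q : formula)
| fImp (p q : formula)
| fAll (p : formula)
| fEx (p : formula).

Definition scons {V : Type} (x : V) (e : nat -> V) (n : nat) : V :=
  match n with O => x | S k => e k end.

Fixpoint sat {V : Type} (mem : V -> V -> Prop) (e : nat -> V) (p : formula)
  : Prop :=
  match p with
  | fMem i j => mem (e i) (e j)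
  | fEq i j => e i = e j
  | fNot p => ~ sat mem e p
  | fAnd p q => sat mem e p /\ sat mem e q
  | fOr p q => sat mem e p \/ sat mem e q
  | fImp p q => sat mem e p -> sat mem e q
  | fAll p => forall x, sat mem (scons x e) p
  | fEx p => exists x, sat mem (scons x e) p
  end.

(** Models of ZF.  In the two schemes the parameters are the values of the
    environment [e]. *)
Record ZF : Type := {
  universe :> Type;
  mem : universe -> universe -> Prop;
  zf_extensionality :
    forall a b, (forall x, mem x a <-> mem x b) -> a = b;
  zf_foundation :
    forall a, (exists x, mem x a) ->
      exists x, mem x a /\ ~ (exists y, mem y x /\ mem y a);
  zf_pairing :
    forall a b, exists c, forall x, mem x c <-> x = a \/ x = b;
  zf_union :
    forall a, exists b, forall x, mem x b <-> exists y, mem y a /\ mem x y;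
  zf_powerset :
    forall a, exists b, forall x,
      mem x b <-> (forall y, mem y x -> mem y a);
  zf_infinity :
    exists i, (exists o, mem o i /\ forall z, ~ mem z o) /\
      (forall x, mem x i ->
         exists y, mem y i /\ forall z, mem z y <-> mem z x \/ z = x);
  zf_separation :
    forall (p : formula) (e : nat -> universe) (a : universe),
      exists b, forall x, mem x b <-> mem x a /\ sat mem (scons x e) p;
  zf_replacement :
    forall (p : formula) (e : nat -> universe) (a : universe),
      (forall x y y', mem x a ->
         sat mem (scons y (scons x e)) p ->
         sat mem (scons y' (scons x e)) p -> y = y') ->
      exists b, forall y,
        mem y b <-> exists x, mem x a /\ sat mem (scons y (scons x e)) p
}.

Arguments mem {z} _ _.

Declare Scope zf_scope.
Delimit Scope zf_scope with zf.
Open Scope zf_scope.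

Notation "x ∈ a" := (mem x a) (at level 70) : zf_scope.
Notation "x ∉ a" := (~ mem x a) (at level 70) : zf_scope.

Lemma universe_inhabited (V : ZF) : inhabited V.
Proof. destruct (zf_infinity V) as [i _]. exact (inhabits i). Qed.

(** All the notions below quantify over elements of the model [V] only, hence
    are interpretations in [V] of first-order formulas. *)

Section Sets.
Context {V : ZF}.
Implicit Types a b f g m n p q r x y z A B F I U W X Y : V.

(** Definite description.  It is only applied to predicates which, by the
    axioms of ZF, hold of exactly one element of [V] in the situations of
    interest, so that it eliminates as usual for defined terms of ZF. *)
Definition the (P : V -> Prop) : V := epsilon (universe_inhabited V) P.

Definition setof (P : V -> Prop) : V := the (fun b => forall x, x ∈ b <-> P x).

Definition subset a b : Prop := forall x, x ∈ a -> x ∈ b.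

Definition empty : V := setof (fun _ => False).
Definition pair a b : V := setof (fun x => x = a \/ x = b).
Definition union a : V := setof (fun x => exists y, y ∈ a /\ x ∈ y).
Definition power a : V := setof (fun x => subset x a).
Definition inter a b : V := setof (fun x => x ∈ a /\ x ∈ b).
Definition diff a b : V := setof (fun x => x ∈ a /\ x ∉ b).
Definition succ a : V := setof (fun x => x ∈ a \/ x = a).

(** Kuratowski pairs. *)
Definition opair a b : V := pair (pair a a) (pair a b).
Definition prod A B : V :=
  setof (fun p => exists a b, a ∈ A /\ b ∈ B /\ p = opair a b).

Definition func f A B : Prop :=
  subset f (prod A B) /\ forall x, x ∈ A -> exists! y, opair x y ∈ f.
Definition app f x : V := the (fun y => opair x y ∈ f).

Definition equipotent A B : Prop :=
  exists f, func f A B /\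
    (forall x y, x ∈ A -> y ∈ A -> app f x = app f y -> x = y) /\
    (forall y, y ∈ B -> exists x, x ∈ A /\ app f x = y).

Definition inductive I : Prop :=
  empty ∈ I /\ forall x, x ∈ I -> succ x ∈ I.
Definition omega : V := setof (fun n => forall I, inductive I -> n ∈ I).

Definition finite A : Prop := exists n, n ∈ omega /\ equipotent A n.
Definition countable A : Prop := exists B, subset B omega /\ equipotent A B.
Definition denumerable A : Prop := ~ finite A /\ countable A.

(** ** Arithmetic of ω; the order is [∈]. *)

Definition nat_add_fun : V := the (fun f =>
  func f (prod omega omega) omega /\
  (forall m, m ∈ omega -> app f (opair m empty) = m) /\
  (forall m n, m ∈ omega -> n ∈ omega ->
     app f (opair m (succ n)) = succ (app f (opair m n)))).
Definition nat_add m n : V := app nat_add_fun (opair m n).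

Definition nat_mul_fun : V := the (fun f =>
  func f (prod omega omega) omega /\
  (forall m, m ∈ omega -> app f (opair m empty) = empty) /\
  (forall m n, m ∈ omega -> n ∈ omega ->
     app f (opair m (succ n)) = nat_add (app f (opair m n)) m)).
Definition nat_mul m n : V := app nat_mul_fun (opair m n).

(** ** Rational numbers

    [frac a b n] represents the rational number (a - b) / n.  Rationals are
    kept as fractions, compared by [frac_eq] and [frac_lt], instead of being
    taken modulo [frac_eq]. *)

Definition frac a b n : V := opair (opair a b) n.

Definition is_frac q a b n : Prop :=
  a ∈ omega /\ b ∈ omega /\ n ∈ omega /\ n <> empty /\ q = frac a b n.

Definition fracs : V := setof (fun q => exists a b n, is_frac q a b n).

(** (a - b) / n = (a' - b') / n' *)
Definition frac_eq p q : Prop :=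
  exists a b n a' b' n', is_frac p a b n /\ is_frac q a' b' n' /\
    nat_add (nat_mul a n') (nat_mul b' n) =
    nat_add (nat_mul a' n) (nat_mul b n').

(** (a - b) / n < (a' - b') / n' *)
Definition frac_lt p q : Prop :=
  exists a b n a' b' n', is_frac p a b n /\ is_frac q a' b' n' /\
    nat_add (nat_mul a n') (nat_mul b' n) ∈
    nat_add (nat_mul a' n) (nat_mul b n').

Definition frac_zero : V := frac empty empty (succ empty).

Definition frac_add p q : V := the (fun r =>
  exists a b n a' b' n', is_frac p a b n /\ is_frac q a' b' n' /\
    r = frac (nat_add (nat_mul a n') (nat_mul a' n))
             (nat_add (nat_mul b n') (nat_mul b' n))
             (nat_mul n n')).

(** ** Real numbers

    Left Dedekind cuts without greatest element.  Since they have no greatest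
    element, closure under [frac_lt] implies closure under [frac_eq]. *)

Definition cut c : Prop :=
  subset c fracs /\
  (exists q, q ∈ c) /\
  (exists q, q ∈ fracs /\ q ∉ c) /\
  (forall p q, q ∈ c -> frac_lt p q -> p ∈ c) /\
  (forall p, p ∈ c -> exists q, q ∈ c /\ frac_lt p q).

Definition reals : V := setof cut.

Definition real_zero : V := setof (fun q => frac_lt q frac_zero).
Definition real_le x y : Prop := subset x y.
Definition real_lt x y : Prop := real_le x y /\ x <> y.
Definition real_add x y : V := setof (fun r =>
  exists p q, p ∈ x /\ q ∈ y /\ frac_eq r (frac_add p q)).

(** ** Topological spaces: a set [X] with its family [t] of open sets. *)

Definition topology X (t : V) : Prop :=
  subset t (power X) /\
  empty ∈ t /\ X ∈ t /\
  (forall U W, U ∈ t -> W ∈ t -> inter U W ∈ t) /\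
  (forall F, subset F t -> union F ∈ t).

Definition closed X (t : V) A : Prop := subset A X /\ diff X A ∈ t.

Definition closure X (t : V) A : V :=
  setof (fun x => x ∈ X /\
    forall C : V, closed X t C -> subset A C -> x ∈ C).

Definition subspace (t : V) Y : V :=
  setof (fun W => exists U, U ∈ t /\ W = inter U Y).

Definition hausdorff X (t : V) : Prop :=
  forall x y, x ∈ X -> y ∈ X -> x <> y ->
    exists U W, U ∈ t /\ W ∈ t /\ x ∈ U /\ y ∈ W /\ inter U W = empty.

Definition first_countable X (t : V) : Prop :=
  forall x, x ∈ X ->
    exists B, subset B t /\ countable B /\
      (forall U, U ∈ B -> x ∈ U) /\
      (forall U, U ∈ t -> x ∈ U -> exists W, W ∈ B /\ subset W U).

Definition sequence_in (s : V) A : Prop := func s omega A.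

Definition converges X (t s : V) x : Prop :=
  x ∈ X /\
  forall U, U ∈ t -> x ∈ U ->
    exists m, m ∈ omega /\
      forall n, n ∈ omega -> m ∈ n \/ m = n -> app s n ∈ U.

Definition sequentially_closed X (t : V) A : Prop :=
  subset A X /\
  forall (s : V) x, sequence_in s A -> converges X t s x -> x ∈ A.

Definition sequential X (t : V) : Prop :=
  forall A, sequentially_closed X t A <-> closed X t A.

Definition hereditarily_sequential X (t : V) : Prop :=
  forall Y, subset Y X -> sequential Y (subspace t Y).

Definition frechet_urysohn X (t : V) : Prop :=
  forall A x, subset A X -> x ∈ closure X t A ->
    exists s : V, sequence_in s A /\ converges X t s x.

(** ** Metrizable spaces *)

Definition dist (d : V) x y : V := app d (opair x y).

Definition metric X (d : V) : Prop :=
  func d (prod X X) reals /\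
  (forall x y, x ∈ X -> y ∈ X -> real_le real_zero (dist d x y)) /\
  (forall x y, x ∈ X -> y ∈ X -> (dist d x y = real_zero <-> x = y)) /\
  (forall x y, x ∈ X -> y ∈ X -> dist d x y = dist d y x) /\
  (forall x y z, x ∈ X -> y ∈ X -> z ∈ X ->
     real_le (dist d x z) (real_add (dist d x y) (dist d y z))).

Definition ball X (d : V) x r : V :=
  setof (fun y => y ∈ X /\ real_lt (dist d x y) r).

Definition metric_topology X (d : V) : V :=
  setof (fun U => subset U X /\
    forall x, x ∈ U ->
      exists r, r ∈ reals /\ real_lt real_zero r /\ subset (ball X d x r) U).

Definition metrizable X (t : V) : Prop :=
  exists d : V, metric X d /\ t = metric_topology X d.

Definition choice_function f F : Prop :=
  func f F (union F) /\ forall A, A ∈ F -> app f A ∈ A.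

End Sets.

(** ** The statements, interpreted in a model of ZF *)

Definition CAC (V : ZF) : Prop :=
  forall F : V, denumerable F -> (forall A, A ∈ F -> A <> empty) ->
    exists f : V, choice_function f F.

Definition FU_M (V : ZF) : Prop :=
  forall X t : V, topology X t -> metrizable X t -> frechet_urysohn X t.

Definition S_M (V : ZF) : Prop :=
  forall X t : V, topology X t -> metrizable X t -> sequential X t.

Definition HS_M (V : ZF) : Prop :=
  forall X t : V, topology X t -> metrizable X t ->
    forall Y : V, subset Y X -> sequential Y (subspace t Y).

Definition first_countable_hausdorff_FU (V : ZF) : Prop :=
  forall X t : V, topology X t -> first_countable X t -> hausdorff X t ->
    frechet_urysohn X t.

Definition first_countable_hausdorff_S (V : ZF) : Prop :=
  forall X t : V, topology X t -> first_countable X t -> hausdorff X t ->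
    sequential X t.

Definition first_countable_hausdorff_HS (V : ZF) : Prop :=
  forall X t : V, topology X t -> first_countable X t -> hausdorff X t ->
    hereditarily_sequential X t.

(* Main.v *)
From Stdlib Require Import Classical ClassicalEpsilon FunctionalExtensionality
  PropExtensionality PeanoNat Ring.
Require Import Defs.

(** A Fréchet-Urysohn space is hereditarily sequential and metrizable spaces are
    first-countable and Hausdorff, so the six topological statements all lie
    between two of them: that first-countable Hausdorff spaces are
    Fréchet-Urysohn, the strongest, and that metrizable spaces are sequential,
    the weakest.  It remains to derive the first from CAC and CAC from the second.

    [CAC_frechet_urysohn]: let x be in the closure of A and let (U_n) be a
    countable base at x.  The sets N_n, intersections of the U_i with i < n, are
    neighbourhoods of x, hence meet A.  CAC, applied to the sets {n} x (A ∩ N_n),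
    gives a sequence of points of A that converges to x.

    [S_M_CAC]: let the members of the denumerable family F be indexed by distinct
    natural numbers.  Consider the set X of all pairs (n, h) where h is a choice
    function on the members of F of index less than n.  Finitely many choices need
    no axiom, so every level n is inhabited; level 0 has a single point o.  Two
    distinct points have distance 1/n, where n is the smaller of their positive
    levels; the distance from o to a point of level n > 0 is thus 1/n.  This is a
    metric in which o is not isolated, so X minus o is not closed.  As X is
    sequential, some sequence (n_k, h_k) of points other than o converges to o,
    hence n_k tends to infinity.  A choice function on F sends B to the value at B
    of the first h_k that is defined at B.

    All this takes place in a model V of ZF, whose natural numbers may be
    nonstandard.  Separation and induction need formulas, which the tactic
    [definable] finds: [definable P] says that P is expressed by a formula with
    parameters in V, and this is closed under connectives, quantifiers and defined
    terms.  Even a description [the P] of a set that does not exist is definable,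
    since by extensionality all such descriptions have the same value.  Addition
    and multiplication come from a recursion theorem on ω; from there on, natural
    numbers form a semiring on which [ring] works, and the few facts needed on
    fractions and cuts follow by cross-multiplication. *)

(** * Definability with parameters *)

(** Renaming of the free variables of a formula; [g] is lifted under binders. *)
Fixpoint rename (g : nat -> nat) (p : formula) : formula :=
  let lift n := match n with O => O | S k => S (g k) end in
  match p with
  | fMem i j => fMem (g i) (g j)
  | fEq i j => fEq (g i) (g j)
  | fNot p => fNot (rename g p)
  | fAnd p q => fAnd (rename g p) (rename g q)
  | fOr p q => fOr (rename g p) (rename g q)
  | fImp p q => fImp (rename g p) (rename g q)
  | fAll p => fAll (rename lift p)
  | fEx p => fEx (rename lift p)
  end.

Section Models.
Context {V : ZF}.

Lemma sat_rename p : forall g (e e' : nat -> V),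
  (forall n, e' n = e (g n)) -> sat mem e (rename g p) <-> sat mem e' p.
Proof.
  induction p; intros g e e' H; simpl;
    try (rewrite !H; tauto);
    try (specialize (IHp1 g e e' H); specialize (IHp2 g e e' H); tauto).
  - specialize (IHp g e e' H); tauto.
  - split; intros K x; specialize (K x);
      (eapply IHp; [|exact K]; intros [|n]; simpl; auto) ||
      (eapply IHp in K; [exact K|]; intros [|n]; simpl; auto).
  - split; intros [x K]; exists x;
      (eapply IHp; [|exact K]; intros [|n]; simpl; auto) ||
      (eapply IHp in K; [exact K|]; intros [|n]; simpl; auto).
Qed.

(** The value of a symbol that is either a variable or a parameter. *)
Definition lookup (e : nat -> V) (s : nat + V) : V :=
  match s with inl i => e i | inr v => v end.

(** [P] depends on an environment of values for its variables.  It is definable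
    if some formula expresses it, each free variable of the formula standing for
    a variable of [P] or for a fixed element of the model. *)
Definition definable (P : (nat -> V) -> Prop) : Prop :=
  exists p (s : nat -> nat + V),
    forall e, sat mem (fun n => lookup e (s n)) p <-> P e.

(** A term is definable when its graph is; variable 0 stands for the value. *)
Definition definable_term (t : (nat -> V) -> V) : Prop :=
  definable (fun e => e 0 = t (fun n => e (S n))).

Lemma definable_iff P Q :
  (forall e, P e <-> Q e) -> definable P -> definable Q.
Proof.
  intros H (p & s & K). exists p, s. intros e. rewrite K. apply H.
Qed.

Lemma definable_rename P (g : nat -> nat) :
  definable P -> definable (fun e => P (fun n => e (g n))).
Proof.
  intros (p & s & K).
  exists p, (fun n => match s n with inl i => inl (g i) | inr v => inr v end).
  intros e. rewrite <- K.
  replace (fun n => lookup e _) with (fun n => lookup (fun n => e (g n)) (s n)).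
  - tauto.
  - extensionality n. destruct (s n); reflexivity.
Qed.

Lemma definable_const (P : Prop) : definable (fun _ => P).
Proof.
  destruct (classic P) as [H|H].
  - exists (fEq 0 0), (fun n => inl n). intros e; simpl. tauto.
  - exists (fNot (fEq 0 0)), (fun n => inl n). intros e; simpl. tauto.
Qed.

Lemma definable_mem_var i j : definable (fun e => e i ∈ e j).
Proof. exists (fMem i j), (fun n => inl n). intros e; simpl. tauto. Qed.

Lemma definable_eq_var i j : definable (fun e => e i = e j).
Proof. exists (fEq i j), (fun n => inl n). intros e; simpl. tauto. Qed.

Lemma definable_eq_const i c : definable (fun e => e i = c).
Proof.
  exists (fEq 0 1), (fun n => match n with O => inl i | _ => inr c end).
  intros e; simpl. tauto.
Qed.

Lemma definable_not P : definable P -> definable (fun e => ~ P e).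
Proof.
  intros (p & s & K). exists (fNot p), s. intros e. simpl. rewrite K. tauto.
Qed.

Lemma definable_and P Q :
  definable P -> definable Q -> definable (fun e => P e /\ Q e).
Proof.
  intros (p & s & K) (q & u & L).
  (* The two assignments of the free variables are interleaved. *)
  exists (fAnd (rename (fun n => 2 * n) p) (rename (fun n => S (2 * n)) q)),
    (fun n => if Nat.even n then s (Nat.div2 n) else u (Nat.div2 n)).
  intros e. cbn [sat]. rewrite <- K, <- L.
  rewrite (sat_rename p _ _ (fun n => lookup e (s n))),
          (sat_rename q _ _ (fun n => lookup e (u n))).
  - tauto.
  - intros n. rewrite Nat.even_succ, <- Nat.negb_even, Nat.even_even,
      Nat.div2_succ_double. reflexivity.
  - intros n. rewrite Nat.even_even, Nat.div2_double. reflexivity.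
Qed.

(** Variable 0 of a definable predicate can be made variable 0 of the formula,
    its other variables being shifted. *)
Lemma definable_open P : definable P ->
  exists p s, forall e x,
    sat mem (scons x (fun n => lookup e (s n))) p <-> P (scons x e).
Proof.
  intros (p & s & K).
  exists (rename (fun n => match s n with inl O => O | _ => S n end) p),
    (fun n => match s n with inl (S i) => inl i | v => v end).
  intros e x. rewrite <- K. apply sat_rename.
  intros n. destruct (s n) as [[|i]|v] eqn:E; simpl; rewrite ?E; reflexivity.
Qed.

Lemma definable_all (Q : V -> (nat -> V) -> Prop) :
  definable (fun e => Q (e 0) (fun n => e (S n))) ->
  definable (fun e => forall x, Q x e).
Proof.
  intros H. destruct (definable_open _ H) as (p & s & K).
  exists (fAll p), s. intros e. simpl.
  split; intros L x; specialize (L x); apply K in L || apply K; exact L.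
Qed.

Lemma definable_or P Q :
  definable P -> definable Q -> definable (fun e => P e \/ Q e).
Proof.
  intros H K. apply definable_iff with (fun e => ~ (~ P e /\ ~ Q e)).
  - intros e. tauto.
  - auto using definable_not, definable_and.
Qed.

Lemma definable_imp P Q :
  definable P -> definable Q -> definable (fun e => P e -> Q e).
Proof.
  intros H K. apply definable_iff with (fun e => ~ (P e /\ ~ Q e)).
  - intros e. tauto.
  - auto using definable_not, definable_and.
Qed.

Lemma definable_equiv P Q :
  definable P -> definable Q -> definable (fun e => P e <-> Q e).
Proof. intros H K. apply definable_and; apply definable_imp; assumption. Qed.

Lemma definable_ex (Q : V -> (nat -> V) -> Prop) :
  definable (fun e => Q (e 0) (fun n => e (S n))) ->
  definable (fun e => exists x, Q x e).
Proof.
  intros H. apply definable_iff with (fun e => ~ forall x, ~ Q x e).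
  - intros e. split.
    + intros K. apply NNPP. intros L. apply K. intros x M. apply L.
      exists x. exact M.
    + intros [x K] L. exact (L x K).
  - apply definable_not, (definable_all (fun x e => ~ Q x e)), definable_not, H.
Qed.

(** A term can be substituted for a variable; the cases of a fixed number of
    arguments follow. *)
Lemma definable_subst (R : V -> (nat -> V) -> Prop) t :
  definable (fun e => R (e 0) (fun n => e (S n))) -> definable_term t ->
  definable (fun e => R (t e) e).
Proof.
  intros H K. apply definable_iff with (fun e => exists x, x = t e /\ R x e).
  - intros e. split; [intros (x & -> & L); exact L | eauto].
  - apply (definable_ex (fun x e => x = t e /\ R x e)), definable_and; assumption.
Qed.

Lemma definable_rel1 (R : V -> Prop) a :
  definable (fun e => R (e 0)) -> definable_term a ->
  definable (fun e => R (a e)).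
Proof. intros H K. exact (definable_subst (fun x _ => R x) a H K). Qed.

Lemma definable_rel2 (R : V -> V -> Prop) a b :
  definable (fun e => R (e 0) (e 1)) ->
  definable_term a -> definable_term b ->
  definable (fun e => R (a e) (b e)).
Proof.
  intros H K L.
  apply (definable_subst (fun x e => R x (b e)) a); [|exact K].
  apply (definable_subst (fun y e => R (e 0) y) (fun e => b (fun n => e (S n)))).
  - exact (definable_rename _ (fun n => match n with 0 => 1 | _ => 0 end) H).
  - exact (definable_rename _ (fun n => match n with 0 => 0 | S k => S (S k) end) L).
Qed.

Lemma definable_rel3 (R : V -> V -> V -> Prop) a b c :
  definable (fun e => R (e 0) (e 1) (e 2)) ->
  definable_term a -> definable_term b -> definable_term c ->
  definable (fun e => R (a e) (b e) (c e)).
Proof.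
  intros H K L M.
  apply (definable_subst (fun x e => R x (b e) (c e)) a); [|exact K].
  apply (definable_subst (fun y e => R (e 0) y (c (fun n => e (S n))))
           (fun e => b (fun n => e (S n)))).
  - apply (definable_subst (fun z e => R (e 1) (e 0) z)
             (fun e => c (fun n => e (S (S n))))).
    + exact (definable_rename _
               (fun n => match n with 0 => 2 | 1 => 1 | _ => 0 end) H).
    + exact (definable_rename _
               (fun n => match n with 0 => 0 | S k => S (S (S k)) end) M).
  - exact (definable_rename _
             (fun n => match n with 0 => 0 | S k => S (S k) end) L).
Qed.

Lemma definable_term_var i : definable_term (fun e => e i).
Proof. exact (definable_eq_var 0 (S i)). Qed.

Lemma definable_term_const c : definable_term (fun _ => c).
Proof. exact (definable_eq_const 0 c). Qed.

Lemma definable_fun1 (F : V -> V) a :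
  definable (fun e => e 0 = F (e 1)) -> definable_term a ->
  definable_term (fun e => F (a e)).
Proof.
  intros H K. apply (definable_rel2 (fun y x => y = F x)).
  - exact H.
  - apply definable_term_var.
  - exact (definable_rename _ (fun n => match n with 0 => 0 | S k => S (S k) end) K).
Qed.

Lemma definable_fun2 (F : V -> V -> V) a b :
  definable (fun e => e 0 = F (e 1) (e 2)) ->
  definable_term a -> definable_term b ->
  definable_term (fun e => F (a e) (b e)).
Proof.
  intros H K L. apply (definable_rel3 (fun y x x' => y = F x x')).
  - exact H.
  - apply definable_term_var.
  - exact (definable_rename _ (fun n => match n with 0 => 0 | S k => S (S k) end) K).
  - exact (definable_rename _ (fun n => match n with 0 => 0 | S k => S (S k) end) L).
Qed.

Lemma definable_mem a b : definable_term a -> definable_term b ->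
  definable (fun e => a e ∈ b e).
Proof. apply (definable_rel2 (fun x y => x ∈ y)), definable_mem_var. Qed.

Lemma definable_eq a b : definable_term a -> definable_term b ->
  definable (fun e => a e = b e).
Proof. apply (definable_rel2 (fun x y => x = y)), definable_eq_var. Qed.

Lemma the_spec (P : V -> Prop) : (exists x, P x) -> P (the P).
Proof. apply epsilon_spec. Qed.

Lemma the_eq (P : V -> Prop) x :
  P x -> (forall y, P y -> y = x) -> the P = x.
Proof. intros H K. apply K, the_spec. exists x. exact H. Qed.

(** A description is definable even where it describes nothing: by
    extensionality its value there does not depend on the environment. *)
Lemma definable_the (P : V -> (nat -> V) -> Prop) :
  (forall e x y, P x e -> P y e -> x = y) ->
  definable (fun e => P (e 0) (fun n => e (S n))) ->
  definable_term (fun e => the (fun x => P x e)).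
Proof.
  intros U H. unfold definable_term.
  apply definable_iff with (fun e =>
    P (e 0) (fun n => e (S n)) \/
    ((~ exists x, P x (fun n => e (S n))) /\ e 0 = the (fun _ => False))).
  - intros e. split.
    + intros [K|[K ->]].
      * symmetry. apply the_eq; [exact K|]. intros y L. exact (U _ _ _ L K).
      * f_equal. extensionality x. apply propositional_extensionality.
        split; [tauto|]. intros L. apply K. exists x. exact L.
    + intros K. destruct (classic (exists x, P x (fun n => e (S n)))) as [L|L].
      * left. rewrite K. exact (the_spec (fun x => P x _) L).
      * right. split; [exact L|]. rewrite K. f_equal. extensionality x.
        apply propositional_extensionality.
        split; [|tauto]. intros M. apply L. exists x. exact M.
  - apply definable_or; [exact H|].
    apply definable_and; [|apply definable_eq_const].
    apply definable_not,
      (definable_ex (fun x e => P x (fun n => e (S n)))).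
    exact (definable_rename _ (fun n => match n with 0 => 0 | S k => S (S k) end) H).
Qed.

Lemma definable_setof (P : V -> (nat -> V) -> Prop) :
  definable (fun e => P (e 0) (fun n => e (S n))) ->
  definable_term (fun e => setof (fun x => P x e)).
Proof.
  intros H. apply (definable_the (fun b e => forall x, x ∈ b <-> P x e)).
  - intros e x y K L. apply zf_extensionality. intros z. rewrite K, L. tauto.
  - apply (definable_all (fun x e => x ∈ e 0 <-> P x (fun n => e (S n)))).
    apply definable_equiv; [apply definable_mem_var|].
    exact (definable_rename _ (fun n => match n with 0 => 0 | S k => S (S k) end) H).
Qed.

(** A function applied to a term is definable when the function is a fixed
    element of the model. *)
Lemma definable_app (f : V) a :
  (forall x y y', opair x y ∈ f -> opair x y' ∈ f -> y = y') ->
  definable (fun e => opair (e 0) (e 1) ∈ f) ->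
  definable_term a -> definable_term (fun e => app f (a e)).
Proof.
  intros U H K. apply (definable_fun1 (app f)); [|exact K].
  apply (definable_the (fun y e => opair (e 0) y ∈ f)).
  - intros e x y L M. exact (U _ _ _ L M).
  - exact (definable_rename _ (fun n => match n with 0 => 1 | _ => 0 end) H).
Qed.

Lemma definable_subset a b : definable_term a -> definable_term b ->
  definable (fun e => subset (a e) (b e)).
Proof.
  apply (definable_rel2 subset).
  apply (definable_all (fun x e => x ∈ e 0 -> x ∈ e 1)).
  apply definable_imp; apply definable_mem_var.
Qed.

(** Applies the definability lemma of a defined symbol; redefined below, each time
    that new symbols get their lemma. *)
Ltac definable_symbol := fail.

Ltac definable_step :=
  cbv beta;
  lazymatch goal with
  | |- definable (fun e => _ /\ _) => apply definable_and
  | |- definable (fun e => _ \/ _) => apply definable_or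
  | |- definable (fun e => ~ _) => apply definable_not
  | |- definable (fun e => _ <-> _) => apply definable_equiv
  | |- definable _ => first
    [ apply definable_const
    | apply definable_mem
    | apply definable_eq
    | apply definable_subset
    | definable_symbol
    | apply definable_imp
    | match goal with |- definable (fun e => exists x, @?Q x e) =>
        apply (definable_ex (fun x e => Q x e)) end
    | match goal with |- definable (fun e => forall x, @?Q x e) =>
        apply (definable_all (fun x e => Q x e)) end
    ]
  | |- definable_term _ => first
    [ apply definable_term_const
    | apply definable_term_var
    | definable_symbol
    | match goal with |- definable_term (fun e => setof (@?Q e)) =>
        apply (definable_setof (fun x e => Q e x)) end
    ]
  end.

(** Proves definability by recursion on the syntax of the predicate or term.
    Goals about abstract predicates are left to the user. *)
Ltac definable := repeat definable_step.

Opaque definable definable_term.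

(** * Sets, pairs and functions *)

Lemma setof_spec (P : V -> Prop) :
  (exists b, forall x, x ∈ b <-> P x) -> forall x, x ∈ setof P <-> P x.
Proof. intros H. exact (the_spec _ H). Qed.

(** Separation: a definable predicate that only holds of elements of some set
    defines a set. *)
Lemma in_setof (A : V) (P : V -> Prop) :
  definable (fun e => P (e 0)) -> (forall x, P x -> x ∈ A) ->
  forall x, x ∈ setof P <-> P x.
Proof.
  intros H K. apply setof_spec.
  destruct (definable_open _ H) as (p & s & L).
  destruct (zf_separation V p (fun n => lookup (fun _ => A) (s n)) A)
    as [b M].
  exists b. intros x. rewrite M, L. simpl. split; [tauto|auto].
Qed.

Lemma set_ext (a b : V) : (forall x, x ∈ a <-> x ∈ b) -> a = b.
Proof. apply zf_extensionality. Qed.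

Lemma subset_antisym (a b : V) : subset a b -> subset b a -> a = b.
Proof. intros H K. apply set_ext. intros x. split; [apply H | apply K]. Qed.

Lemma in_empty (x : V) : x ∉ empty.
Proof.
  destruct (universe_inhabited V) as [a].
  unfold empty. rewrite (in_setof a); [tauto | definable | tauto].
Qed.

Lemma empty_or_inhabited (a : V) : a = empty \/ exists x, x ∈ a.
Proof.
  destruct (classic (exists x, x ∈ a)) as [H|H]; [tauto|].
  left. apply set_ext. intros x. split; intros K.
  - exfalso. eauto.
  - destruct (in_empty _ K).
Qed.

Lemma in_pair (a b x : V) : x ∈ pair a b <-> x = a \/ x = b.
Proof.
  apply (setof_spec (fun x => x = a \/ x = b)), zf_pairing.
Qed.

Lemma in_union (a x : V) : x ∈ union a <-> exists y, y ∈ a /\ x ∈ y.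
Proof. apply (setof_spec (fun x => exists y, y ∈ a /\ x ∈ y)), zf_union. Qed.

Lemma in_power (a x : V) : x ∈ power a <-> subset x a.
Proof. apply (setof_spec (fun x => subset x a)), zf_powerset. Qed.

Lemma in_inter (a b x : V) : x ∈ inter a b <-> x ∈ a /\ x ∈ b.
Proof. apply (in_setof a (fun x => x ∈ a /\ x ∈ b)); [definable | tauto]. Qed.

Lemma in_diff (a b x : V) : x ∈ diff a b <-> x ∈ a /\ x ∉ b.
Proof. apply (in_setof a (fun x => x ∈ a /\ x ∉ b)); [definable | tauto]. Qed.

Lemma in_succ (a x : V) : x ∈ succ a <-> x ∈ a \/ x = a.
Proof.
  apply (in_setof (union (pair a (pair a a))) (fun x => x ∈ a \/ x = a));
    [definable|].
  intros y H. apply in_union. destruct H as [H| ->].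
  - exists a. rewrite in_pair. tauto.
  - exists (pair a a). rewrite !in_pair. tauto.
Qed.

Lemma opair_inj (a b c d : V) : opair a b = opair c d -> a = c /\ b = d.
Proof.
  unfold opair. intros H.
  assert (K : forall x, (x = pair a a \/ x = pair a b) <->
                        (x = pair c c \/ x = pair c d)).
  { intros x. rewrite <- !in_pair, H. tauto. }
  assert (E : forall x y z w : V, pair x y = pair z w ->
            forall v, (v = x \/ v = y) <-> (v = z \/ v = w)).
  { intros x y z w L v. rewrite <- !in_pair, L. tauto. }
  assert (A : a = c).
  { destruct (proj1 (K (pair a a)) (or_introl eq_refl)) as [L|L];
      pose proof (proj2 (E _ _ _ _ L c) (or_introl eq_refl)); intuition. }
  subst c. split; [reflexivity|].
  destruct (proj1 (K (pair a b)) (or_intror eq_refl)) as [L|L];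
    pose proof (proj1 (E _ _ _ _ L b) (or_intror eq_refl)) as B;
    destruct (proj2 (K (pair a d)) (or_intror eq_refl)) as [M|M];
    pose proof (proj1 (E _ _ _ _ M d) (or_intror eq_refl)) as D;
    intuition congruence.
Qed.

Lemma definable_pair a b : definable_term a -> definable_term b ->
  definable_term (fun e : nat -> V => pair (a e) (b e)).
Proof. apply definable_fun2. unfold pair. definable. Qed.

Lemma definable_inter a b : definable_term a -> definable_term b ->
  definable_term (fun e : nat -> V => inter (a e) (b e)).
Proof. apply definable_fun2. unfold inter. definable. Qed.

Lemma definable_diff a b : definable_term a -> definable_term b ->
  definable_term (fun e : nat -> V => diff (a e) (b e)).
Proof. apply definable_fun2. unfold diff. definable. Qed.

Lemma definable_succ a : definable_term a ->
  definable_term (fun e : nat -> V => succ (a e)).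
Proof. apply definable_fun1. unfold succ. definable. Qed.

Lemma definable_opair a b : definable_term a -> definable_term b ->
  definable_term (fun e : nat -> V => opair (a e) (b e)).
Proof.
  intros H K. unfold opair. apply definable_pair; apply definable_pair; assumption.
Qed.

Ltac definable_sets := first
  [ apply definable_pair | apply definable_inter | apply definable_diff
  | apply definable_succ | apply definable_opair ].
Ltac definable_symbol ::= definable_sets.

Lemma in_prod (A B p : V) :
  p ∈ prod A B <-> exists a b, a ∈ A /\ b ∈ B /\ p = opair a b.
Proof.
  apply (in_setof (power (power (union (pair A B))))
    (fun p => exists a b, a ∈ A /\ b ∈ B /\ p = opair a b)); [definable|].
  intros q (a & b & Ha & Hb & ->). apply in_power. intros x H.
  apply in_power. intros y K. apply in_union.
  apply in_pair in H. destruct H as [-> | ->]; apply in_pair in K;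
    destruct K as [-> | ->];
    ((exists A; rewrite in_pair; tauto) || (exists B; rewrite in_pair; tauto)).
Qed.

Lemma opair_in_prod (A B a b : V) :
  opair a b ∈ prod A B <-> a ∈ A /\ b ∈ B.
Proof.
  rewrite in_prod. split.
  - intros (c & d & Hc & Hd & E). apply opair_inj in E.
    destruct E as [-> ->]. tauto.
  - intros [H K]. eauto.
Qed.

Lemma definable_prod a b : definable_term a -> definable_term b ->
  definable_term (fun e : nat -> V => prod (a e) (b e)).
Proof. apply definable_fun2. unfold prod. definable. Qed.

Lemma func_app (f A B x : V) :
  func f A B -> x ∈ A -> opair x (app f x) ∈ f /\ app f x ∈ B.
Proof.
  intros [H K] L. destruct (K x L) as (y & M & U).
  assert (N : opair x (app f x) ∈ f)
    by (apply (the_spec (fun y => opair x y ∈ f)); eauto).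
  split; [exact N|]. apply H, opair_in_prod in N. tauto.
Qed.

Lemma app_in (f A B x : V) : func f A B -> x ∈ A -> app f x ∈ B.
Proof. intros H K. apply (func_app f A B x H K). Qed.

Lemma func_eq (f A B x y : V) :
  func f A B -> opair x y ∈ f -> x ∈ A /\ y ∈ B /\ app f x = y.
Proof.
  intros F H. assert (K := proj1 F _ H). apply opair_in_prod in K.
  destruct K as [K L]. split; [exact K|]. split; [exact L|].
  destruct (proj2 F x K) as (z & _ & U).
  rewrite <- (U y H). symmetry. apply U. apply (func_app f A B x F K).
Qed.

Lemma definable_func_app (f A B : V) a : func f A B ->
  definable_term a -> definable_term (fun e => app f (a e)).
Proof.
  intros F. apply definable_app.
  - intros x y y' H K. apply (func_eq f A B) in H, K; [|exact F..].
    destruct H as (_ & _ & <-), K as (_ & _ & <-). reflexivity.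
  - definable.
Qed.

Lemma definable_func a b c :
  definable_term a -> definable_term b -> definable_term c ->
  definable (fun e : nat -> V => func (a e) (b e) (c e)).
Proof.
  apply definable_rel3. unfold func.
  apply definable_and; [apply definable_subset; [definable|]|].
  - apply definable_prod; definable.
  - unfold unique. definable.
Qed.

(** A definable functional relation on a set is the graph of a function. *)
Lemma exists_func (A B : V) (R : V -> V -> Prop) :
  definable (fun e => R (e 0) (e 1)) ->
  (forall x, x ∈ A -> exists! y, y ∈ B /\ R x y) ->
  exists f, func f A B /\ forall x, x ∈ A -> R x (app f x).
Proof.
  intros D H.
  assert (Ef : exists f, forall p, p ∈ f <->
    p ∈ prod A B /\ exists x y, p = opair x y /\ R x y).
  { eexists. apply (in_setof (prod A B) (fun p =>
      p ∈ prod A B /\ exists x y, p = opair x y /\ R x y)); [|tauto].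
    definable. apply (definable_rel2 R); [exact D|definable..]. }
  destruct Ef as [f Hf].
  assert (F : func f A B).
  { split.
    - intros p K. apply Hf in K. tauto.
    - intros x K. destruct (H x K) as (y & [L M] & U). exists y. split.
      + apply Hf. rewrite opair_in_prod. split; [tauto | eauto].
      + intros z N. apply Hf in N. destruct N as [N (x' & z' & E & Q)].
        apply opair_inj in E. destruct E as [<- <-].
        apply opair_in_prod in N. apply U. tauto. }
  exists f. split; [exact F|]. intros x K.
  destruct (func_app f A B x F K) as [L _]. apply Hf in L.
  destruct L as [_ (x' & y & E & M)]. apply opair_inj in E.
  destruct E as [<- <-]. exact M.
Qed.

Ltac definable_functions := first
  [ definable_sets | apply definable_prod | apply definable_func
  | eapply definable_func_app; [eassumption|] ].
Ltac definable_symbol ::= definable_functions.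

(** * Natural numbers *)

Lemma in_omega (n : V) : n ∈ omega <-> forall I, inductive I -> n ∈ I.
Proof.
  destruct (zf_infinity V) as (I & (o & H & Ho) & K).
  assert (J : inductive I).
  { split.
    - replace empty with o; [exact H|]. apply set_ext. intros x. split; intros L.
      + destruct (Ho _ L).
      + destruct (in_empty _ L).
    - intros x L. destruct (K x L) as (y & M & N).
      replace (succ x) with y; [exact M|]. apply set_ext. intros z.
      rewrite in_succ. apply N. }
  apply (in_setof I (fun n => forall I, inductive I -> n ∈ I)).
  - unfold inductive. definable.
  - intros x L. exact (L I J).
Qed.

Lemma omega_0 : (empty : V) ∈ omega.
Proof. apply in_omega. intros I H. apply H. Qed.

Lemma omega_succ (n : V) : n ∈ omega -> succ n ∈ omega.
Proof.
  rewrite !in_omega. intros H I K. apply K, H, K.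
Qed.

Hint Resolve omega_0 omega_succ : omega.

(** Induction on ω, for definable predicates only. *)
Lemma omega_ind (P : V -> Prop) :
  definable (fun e => P (e 0)) -> P empty ->
  (forall n, n ∈ omega -> P n -> P (succ n)) ->
  forall n, n ∈ omega -> P n.
Proof.
  intros D H K n L.
  assert (S : forall x, x ∈ setof (fun x => x ∈ omega /\ P x) <->
                        x ∈ omega /\ P x).
  { apply (in_setof omega (fun x => x ∈ omega /\ P x)); [|tauto].
    definable. exact D. }
  apply (S n), (proj1 (in_omega n) L). split.
  - apply S. auto with omega.
  - intros x M. apply S in M. apply S. split; [apply omega_succ|apply K]; tauto.
Qed.

Lemma succ_neq_0 (n : V) : succ n <> empty.
Proof. intros H. apply (in_empty n). rewrite <- H. apply in_succ. tauto. Qed.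

Lemma omega_trans (n : V) :
  n ∈ omega -> forall x y, x ∈ y -> y ∈ n -> x ∈ n.
Proof.
  apply (omega_ind (fun n => forall x y, x ∈ y -> y ∈ n -> x ∈ n)).
  - definable.
  - intros x y _ H. destruct (in_empty _ H).
  - clear n. intros n _ IH x y H K. apply in_succ. apply in_succ in K.
    destruct K as [K| ->]; eauto.
Qed.

Lemma omega_irrefl (n : V) : n ∈ omega -> n ∉ n.
Proof.
  apply (omega_ind (fun n => n ∉ n)); [definable | apply in_empty|].
  clear n. intros n H IH K. apply IH. apply in_succ in K. destruct K as [K|K].
  - apply (omega_trans n H n (succ n)); [apply in_succ|]; tauto.
  - rewrite <- K at 2. apply in_succ. tauto.
Qed.

Lemma succ_inj (n m : V) : m ∈ omega -> succ n = succ m -> n = m.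
Proof.
  intros H E.
  assert (A : n ∈ succ m) by (rewrite <- E; apply in_succ; tauto).
  assert (B : m ∈ succ n) by (rewrite E; apply in_succ; tauto).
  apply in_succ in A, B. destruct A as [A|A]; [|exact A].
  destruct B as [B|B]; [|auto]. destruct (omega_irrefl m H).
  eapply omega_trans; eauto.
Qed.

Lemma omega_cases (n : V) :
  n ∈ omega -> n = empty \/ exists k, k ∈ omega /\ n = succ k.
Proof.
  apply (omega_ind (fun n => n = empty \/ exists k, k ∈ omega /\ n = succ k)).
  - definable.
  - tauto.
  - eauto.
Qed.

Lemma zero_in_succ (n : V) : n ∈ omega -> empty ∈ succ n.
Proof.
  apply (omega_ind (fun n => empty ∈ succ n)); [definable| |].
  - apply in_succ. tauto.
  - clear n. intros n _ IH. apply in_succ. tauto.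
Qed.

Lemma succ_mono (n : V) : n ∈ omega -> forall m, m ∈ n -> succ m ∈ succ n.
Proof.
  apply (omega_ind (fun n => forall m, m ∈ n -> succ m ∈ succ n)); [definable| |].
  - intros m H. destruct (in_empty _ H).
  - clear n. intros n _ IH m K. apply in_succ in K. apply in_succ.
    destruct K as [K| ->]; auto.
Qed.

Lemma omega_trichotomy (n m : V) :
  n ∈ omega -> m ∈ omega -> n ∈ m \/ n = m \/ m ∈ n.
Proof.
  intros H. revert m.
  apply (omega_ind (fun m => n ∈ m \/ n = m \/ m ∈ n)); [definable| |].
  - destruct (omega_cases n H) as [-> | (k & K & ->)]; [tauto|].
    right; right. apply zero_in_succ, K.
  - intros m K [L|[->|L]].
    + left. apply in_succ. tauto.
    + left. apply in_succ. tauto.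
    + apply succ_mono in L; [|exact H]. apply in_succ in L. intuition.
Qed.

(** Every nonempty definable class of natural numbers has a least element. *)
Lemma omega_least (P : V -> Prop) :
  definable (fun e => P (e 0)) -> (exists n, n ∈ omega /\ P n) ->
  exists n, n ∈ omega /\ P n /\ forall m, m ∈ n -> ~ P m.
Proof.
  intros D (n & H & K). apply NNPP. intros L.
  assert (M : forall n, n ∈ omega -> forall m, m ∈ n -> ~ P m).
  { apply (omega_ind (fun n => forall m, m ∈ n -> ~ P m)).
    - definable. apply (definable_rel1 P); [exact D|definable].
    - intros m M. destruct (in_empty _ M).
    - intros k Hk IH m M. apply in_succ in M. destruct M as [M| ->]; [auto|].
      intros Q. apply L. eauto. }
  apply (M (succ n) (omega_succ n H) n); [apply in_succ; tauto | exact K].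
Qed.

Lemma least_unique (P : V -> Prop) (n m : V) :
  n ∈ omega -> m ∈ omega ->
  P n -> (forall k, k ∈ n -> ~ P k) -> P m -> (forall k, k ∈ m -> ~ P k) ->
  n = m.
Proof.
  intros Hn Hm A B C D.
  destruct (omega_trichotomy n m Hn Hm) as [E|[E|E]]; [|exact E|];
    exfalso; [exact (D n E A) | exact (B m E C)].
Qed.

(** Recursion on the second argument; the graph is the intersection of all the
    relations closed under the recursion equations. *)
Lemma omega_recursion (b : V -> V) (s : V -> V -> V) :
  definable (fun e => e 0 = b (e 1)) ->
  definable (fun e => e 0 = s (e 1) (e 2)) ->
  (forall m, m ∈ omega -> b m ∈ omega) ->
  (forall m y, m ∈ omega -> y ∈ omega -> s m y ∈ omega) ->
  exists f, func f (prod omega omega) omega /\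
    (forall m, m ∈ omega -> app f (opair m empty) = b m) /\
    (forall m n, m ∈ omega -> n ∈ omega ->
       app f (opair m (succ n)) = s m (app f (opair m n))).
Proof.
  intros Db Ds Hb Hs.
  set (W := prod (prod omega omega) omega : V).
  set (cl := fun R : V =>
    (forall m, m ∈ omega -> opair (opair m empty) (b m) ∈ R) /\
    (forall m n y, m ∈ omega -> n ∈ omega -> y ∈ omega ->
       opair (opair m n) y ∈ R -> opair (opair m (succ n)) (s m y) ∈ R)).
  assert (Dcl : definable (fun e => cl (e 0))).
  { unfold cl. definable;
      [apply (definable_fun1 b _ Db) | apply (definable_fun2 s _ _ Ds)];
      definable. }
  assert (Ef : exists f, forall p, p ∈ f <-> p ∈ W /\ forall R, cl R -> p ∈ R).
  { eexists. apply (in_setof W (fun p => p ∈ W /\ forall R, cl R -> p ∈ R));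
      [|tauto].
    definable. apply (definable_rel1 cl); [exact Dcl|definable]. }
  destruct Ef as [f Hf].
  assert (HW : forall m n y : V, m ∈ omega -> n ∈ omega -> y ∈ omega ->
            opair (opair m n) y ∈ W)
    by (intros; unfold W; rewrite !opair_in_prod; tauto).
  assert (cf : cl f).
  { split.
    - intros m H. apply Hf. split; [auto with omega|]. intros R C. exact (proj1 C m H).
    - intros m n y Hm Hn Hy K. apply Hf in K. apply Hf.
      split; [auto with omega|]. intros R C. apply (proj2 C); try assumption.
      apply K, C. }
  assert (drop : forall p : V, cl (diff f (pair p p)) -> p ∉ f).
  { intros p C H. apply Hf in H. destruct H as [_ H].
    apply H in C. apply in_diff in C. rewrite in_pair in C. tauto. }
  (* A superfluous pair could be dropped from [f] without spoiling its closure. *)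
  assert (U0 : forall m y, opair (opair m empty) y ∈ f -> y = b m).
  { intros m y H. apply NNPP. intros N. revert H. apply drop. split.
    - intros m' H. apply in_diff. split; [exact (proj1 cf m' H)|]. rewrite in_pair.
      intros K. assert (K' : opair (opair m' empty) (b m') = opair (opair m empty) y)
        by tauto. apply opair_inj in K'. destruct K' as [K1 K2].
      apply opair_inj in K1. apply N. destruct K1 as [-> _]. auto.
    - intros m' n' y' Hm Hn Hy H. apply in_diff in H. apply in_diff.
      split; [apply (proj2 cf); tauto|]. rewrite in_pair. intros K.
      assert (K' : opair (opair m' (succ n')) (s m' y') = opair (opair m empty) y)
        by tauto.
      apply opair_inj in K'. destruct K' as [K' _]. apply opair_inj in K'.
      exact (succ_neq_0 n' (proj2 K')). }
  assert (US : forall m n z, n ∈ omega ->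
     (forall y, opair (opair m n) y ∈ f -> y = z) ->
     forall y, opair (opair m (succ n)) y ∈ f -> y = s m z).
  { intros m n z Hn Uz y H. apply NNPP. intros N. revert H. apply drop. split.
    - intros m' H. apply in_diff. split; [exact (proj1 cf m' H)|]. rewrite in_pair.
      intros K.
      assert (K' : opair (opair m' empty) (b m') = opair (opair m (succ n)) y)
        by tauto. apply opair_inj in K'. destruct K' as [K1 K2].
      apply opair_inj in K1. apply (succ_neq_0 n). symmetry. tauto.
    - intros m' n' y' Hm' Hn' Hy H. apply in_diff in H. apply in_diff.
      split; [apply (proj2 cf); tauto|]. rewrite in_pair. intros K.
      assert (K' : opair (opair m' (succ n')) (s m' y') =
                   opair (opair m (succ n)) y) by tauto.
      apply opair_inj in K'. destruct K' as [K1 K2]. apply opair_inj in K1.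
      destruct K1 as [-> K1]. apply succ_inj in K1; [subst n'|exact Hn].
      apply N. rewrite <- K2. f_equal. apply Uz. tauto. }
  assert (tot : forall m, m ∈ omega -> forall n, n ∈ omega ->
    exists z, z ∈ omega /\ opair (opair m n) z ∈ f /\
      forall y, opair (opair m n) y ∈ f -> y = z).
  { intros m Hm. apply (omega_ind (fun n =>
      exists z, z ∈ omega /\ opair (opair m n) z ∈ f /\
        forall y, opair (opair m n) y ∈ f -> y = z)); [definable| |].
    - exists (b m). split; [auto|]. split; [exact (proj1 cf m Hm) | apply U0].
    - intros n Hn (z & Hz & K & U). exists (s m z).
      split; [auto|]. split; [apply (proj2 cf); assumption | apply US; assumption]. }
  assert (F : func f (prod omega omega) omega).
  { split.
    - intros p H. apply Hf in H. tauto.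
    - intros p H. apply in_prod in H. destruct H as (m & n & Hm & Hn & ->).
      destruct (tot m Hm n Hn) as (z & _ & K & U). exists z.
      split; [exact K|]. intros y L. symmetry. auto. }
  exists f. split; [exact F|]. split.
  - intros m Hm.
    apply (func_eq f (prod omega omega) omega _ _ F). exact (proj1 cf m Hm).
  - intros m n Hm Hn.
    apply (func_eq f (prod omega omega) omega _ _ F).
    assert (K : opair m n ∈ prod omega omega) by (apply opair_in_prod; tauto).
    destruct (func_app f _ _ _ F K). apply (proj2 cf); assumption.
Qed.

(** * Arithmetic *)

Lemma nat_add_spec :
  func nat_add_fun (prod omega omega) (omega : V) /\
  (forall m : V, m ∈ omega -> nat_add m empty = m) /\
  (forall m n : V, m ∈ omega -> n ∈ omega ->
     nat_add m (succ n) = succ (nat_add m n)).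
Proof.
  refine (the_spec (fun f : V => func f (prod omega omega) omega /\
    (forall m, m ∈ omega -> app f (opair m empty) = m) /\
    (forall m n, m ∈ omega -> n ∈ omega ->
       app f (opair m (succ n)) = succ (app f (opair m n)))) _).
  apply (omega_recursion (fun m => m) (fun _ y => succ y)).
  - definable.
  - definable.
  - tauto.
  - auto with omega.
Qed.

Lemma definable_nat_add a b : definable_term a -> definable_term b ->
  definable_term (fun e : nat -> V => nat_add (a e) (b e)).
Proof.
  intros H K. apply (definable_func_app _ _ _ _ (proj1 nat_add_spec)).
  apply definable_opair; assumption.
Qed.

Lemma nat_add_omega (m n : V) : m ∈ omega -> n ∈ omega -> nat_add m n ∈ omega.
Proof.
  intros H K. apply (app_in _ _ _ _ (proj1 nat_add_spec)), opair_in_prod. tauto.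
Qed.

Ltac definable_symbol ::= first
  [ definable_functions | apply definable_nat_add ].

Lemma nat_mul_spec :
  func nat_mul_fun (prod omega omega) (omega : V) /\
  (forall m : V, m ∈ omega -> nat_mul m empty = empty) /\
  (forall m n : V, m ∈ omega -> n ∈ omega ->
     nat_mul m (succ n) = nat_add (nat_mul m n) m).
Proof.
  refine (the_spec (fun f : V => func f (prod omega omega) omega /\
    (forall m, m ∈ omega -> app f (opair m empty) = empty) /\
    (forall m n, m ∈ omega -> n ∈ omega ->
       app f (opair m (succ n)) = nat_add (app f (opair m n)) m)) _).
  apply (omega_recursion (fun m => empty) (fun m y => nat_add y m)).
  - definable.
  - definable.
  - auto with omega.
  - auto using nat_add_omega.
Qed.

Lemma definable_nat_mul a b : definable_term a -> definable_term b ->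
  definable_term (fun e : nat -> V => nat_mul (a e) (b e)).
Proof.
  intros H K. apply (definable_func_app _ _ _ _ (proj1 nat_mul_spec)).
  apply definable_opair; assumption.
Qed.

Lemma nat_mul_omega (m n : V) : m ∈ omega -> n ∈ omega -> nat_mul m n ∈ omega.
Proof.
  intros H K. apply (app_in _ _ _ _ (proj1 nat_mul_spec)), opair_in_prod. tauto.
Qed.

Ltac definable_arithmetic := first
  [ definable_functions | apply definable_nat_add | apply definable_nat_mul ].
Ltac definable_symbol ::= definable_arithmetic.

(** The natural numbers of the model, as a type on which addition and
    multiplication are total. *)
Definition Nt : Type := { n : V | n ∈ omega }.
Definition val (a : Nt) : V := proj1_sig a.

Lemma val_omega (a : Nt) : val a ∈ omega.
Proof. exact (proj2_sig a). Qed.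

Lemma val_inj (a b : Nt) : val a = val b -> a = b.
Proof.
  destruct a as [a H], b as [b K]; simpl. intros ->.
  f_equal. apply proof_irrelevance.
Qed.

Definition nzero : Nt := exist _ empty omega_0.
Definition nsucc (a : Nt) : Nt := exist _ (succ (val a)) (omega_succ _ (val_omega a)).
Definition none : Nt := nsucc nzero.
Definition nadd (a b : Nt) : Nt :=
  exist _ (nat_add (val a) (val b)) (nat_add_omega _ _ (val_omega a) (val_omega b)).
Definition nmul (a b : Nt) : Nt :=
  exist _ (nat_mul (val a) (val b)) (nat_mul_omega _ _ (val_omega a) (val_omega b)).
Definition nlt (a b : Nt) : Prop := val a ∈ val b.

Lemma of_omega (n : V) : n ∈ omega -> exists a, val a = n.
Proof. intros H. exists (exist _ n H). reflexivity. Qed.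

(** Induction on [Nt], where the predicate is given as a definable predicate of
    elements of the model. *)
Lemma Nt_ind (P : Nt -> Prop) (Q : V -> Prop) :
  definable (fun e => Q (e 0)) -> (forall a, P a <-> Q (val a)) ->
  P nzero -> (forall a, P a -> P (nsucc a)) -> forall a, P a.
Proof.
  intros D E H K a. apply E. apply (omega_ind Q D);
    [exact (proj1 (E nzero) H) | | apply val_omega].
  intros n L M. exact (proj1 (E _) (K _ (proj2 (E (exist _ n L)) M))).
Qed.

Lemma Nt_ind_eq (l r : Nt -> Nt) (L R : V -> V) :
  definable (fun e => L (e 0) = R (e 0)) ->
  (forall a, val (l a) = L (val a)) -> (forall a, val (r a) = R (val a)) ->
  l nzero = r nzero -> (forall a, l a = r a -> l (nsucc a) = r (nsucc a)) ->
  forall a, l a = r a.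
Proof.
  intros D HL HR. apply (Nt_ind (fun a => l a = r a) (fun n => L n = R n) D).
  intros a. rewrite <- HL, <- HR. split; [congruence | apply val_inj].
Qed.

Lemma nadd_0_r a : nadd a nzero = a.
Proof. apply val_inj. exact (proj1 (proj2 nat_add_spec) _ (val_omega a)). Qed.

Lemma nadd_succ_r a b : nadd a (nsucc b) = nsucc (nadd a b).
Proof.
  apply val_inj.
  exact (proj2 (proj2 nat_add_spec) _ _ (val_omega a) (val_omega b)).
Qed.

Lemma nmul_0_r a : nmul a nzero = nzero.
Proof. apply val_inj. exact (proj1 (proj2 nat_mul_spec) _ (val_omega a)). Qed.

Lemma nmul_succ_r a b : nmul a (nsucc b) = nadd (nmul a b) a.
Proof.
  apply val_inj.
  exact (proj2 (proj2 nat_mul_spec) _ _ (val_omega a) (val_omega b)).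
Qed.

Lemma val_nzero : val nzero = empty. Proof. reflexivity. Qed.
Lemma val_nsucc a : val (nsucc a) = succ (val a). Proof. reflexivity. Qed.
Lemma val_nadd a b : val (nadd a b) = nat_add (val a) (val b).
Proof. reflexivity. Qed.
Lemma val_nmul a b : val (nmul a b) = nat_mul (val a) (val b).
Proof. reflexivity. Qed.

Opaque val nzero nsucc nadd nmul nat_add nat_mul.

(** Induction on a natural number [a] for an equation between terms in [a]. *)
Ltac nat_induction a :=
  pattern a; match goal with |- (fun a => @?l a = @?r a) _ =>
    revert a; eapply (Nt_ind_eq l r);
    [ | intros a; cbv beta;
        repeat first [rewrite val_nadd | rewrite val_nmul | rewrite val_nsucc];
        rewrite ?val_nzero;
        match goal with |- ?t = ?F _ =>
          match eval pattern (val a) in t with ?G _ => unify F G; reflexivity end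
        end..
      | |];
    [cbv beta; definable | cbv beta..]
  end.

Lemma nadd_0_l a : nadd nzero a = a.
Proof.
  nat_induction a.
  - apply nadd_0_r.
  - intros b H. rewrite nadd_succ_r, H. reflexivity.
Qed.

Lemma nadd_succ_l a b : nadd (nsucc a) b = nsucc (nadd a b).
Proof.
  nat_induction b.
  - rewrite !nadd_0_r. reflexivity.
  - intros b H. rewrite !nadd_succ_r, H. reflexivity.
Qed.

Lemma nadd_comm a b : nadd a b = nadd b a.
Proof.
  nat_induction b.
  - rewrite nadd_0_r, nadd_0_l. reflexivity.
  - intros b H. rewrite nadd_succ_r, nadd_succ_l, H. reflexivity.
Qed.

Lemma nadd_assoc a b c : nadd a (nadd b c) = nadd (nadd a b) c.
Proof.
  nat_induction c.
  - rewrite !nadd_0_r. reflexivity.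
  - intros c H. rewrite !nadd_succ_r, H. reflexivity.
Qed.

Lemma nmul_0_l a : nmul nzero a = nzero.
Proof.
  nat_induction a.
  - apply nmul_0_r.
  - intros b H. rewrite nmul_succ_r, H, nadd_0_r. reflexivity.
Qed.

Lemma nmul_succ_l a b : nmul (nsucc a) b = nadd (nmul a b) b.
Proof.
  nat_induction b.
  - rewrite !nmul_0_r, nadd_0_r. reflexivity.
  - intros b H. rewrite !nmul_succ_r, H, !nadd_succ_r, <- !nadd_assoc.
    rewrite (nadd_comm a b). reflexivity.
Qed.

Lemma nmul_comm a b : nmul a b = nmul b a.
Proof.
  nat_induction b.
  - rewrite nmul_0_r, nmul_0_l. reflexivity.
  - intros b H. rewrite nmul_succ_r, nmul_succ_l, H. reflexivity.
Qed.

Lemma nmul_add_l a b c : nmul (nadd a b) c = nadd (nmul a c) (nmul b c).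
Proof.
  nat_induction c.
  - rewrite !nmul_0_r, nadd_0_r. reflexivity.
  - intros c H. rewrite !nmul_succ_r, H, <- !nadd_assoc. f_equal.
    rewrite !nadd_assoc. f_equal. apply nadd_comm.
Qed.

Lemma nmul_assoc a b c : nmul a (nmul b c) = nmul (nmul a b) c.
Proof.
  nat_induction c.
  - rewrite !nmul_0_r. reflexivity.
  - intros c H. rewrite !nmul_succ_r, <- H.
    rewrite (nmul_comm a (nadd _ _)), nmul_add_l, !(nmul_comm _ a). reflexivity.
Qed.

Lemma nmul_1_l a : nmul none a = a.
Proof. unfold none. rewrite nmul_succ_l, nmul_0_l. apply nadd_0_l. Qed.

Lemma Nt_semi_ring : semi_ring_theory nzero none nadd nmul (@eq Nt).
Proof.
  constructor; auto using nadd_0_l, nadd_comm, nadd_assoc, nmul_1_l, nmul_0_l,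
    nmul_comm, nmul_assoc, nmul_add_l.
Qed.

Add Ring Nt_ring : Nt_semi_ring.

Lemma nsucc_eq a : nsucc a = nadd a none.
Proof. unfold none. rewrite nadd_succ_r, nadd_0_r. reflexivity. Qed.

Lemma nlt_irrefl a : ~ nlt a a.
Proof. apply omega_irrefl, val_omega. Qed.

Lemma nlt_trans a b c : nlt a b -> nlt b c -> nlt a c.
Proof. apply omega_trans, val_omega. Qed.

Lemma nlt_cases a b : nlt a b \/ a = b \/ nlt b a.
Proof.
  destruct (omega_trichotomy (val a) (val b) (val_omega a) (val_omega b))
    as [H|[H|H]]; [tauto | apply val_inj in H; tauto | tauto].
Qed.

Lemma nlt_succ a b : nlt a (nsucc b) <-> nlt a b \/ a = b.
Proof.
  unfold nlt. rewrite val_nsucc, in_succ. split; intros [H|H]; auto.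
  - right. apply val_inj, H.
  - right. congruence.
Qed.

Lemma not_nlt_0 a : ~ nlt a nzero.
Proof. unfold nlt. rewrite val_nzero. apply in_empty. Qed.

Lemma nlt_add_succ a k : nlt a (nadd a (nsucc k)).
Proof.
  revert k. apply (Nt_ind (fun k => nlt a (nadd a (nsucc k)))
    (fun n => val a ∈ nat_add (val a) (succ n))).
  - definable.
  - intros b. unfold nlt. rewrite val_nadd, val_nsucc. tauto.
  - rewrite nadd_succ_r, nadd_0_r. apply nlt_succ. tauto.
  - intros b H. rewrite nadd_succ_r. apply nlt_succ. tauto.
Qed.

Lemma nlt_iff a b : nlt a b <-> exists k, b = nadd a (nsucc k).
Proof.
  split; [|intros [k ->]; apply nlt_add_succ].
  revert b. apply (Nt_ind (fun b => nlt a b -> exists k, b = nadd a (nsucc k))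
    (fun n => val a ∈ n ->
       exists k, k ∈ omega /\ n = nat_add (val a) (succ k))).
  - definable.
  - intros c. split; intros H K; destruct (H K) as [k L].
    + exists (val k). split; [apply val_omega|]. rewrite L at 1.
      rewrite val_nadd, val_nsucc. reflexivity.
    + destruct L as [L M]. destruct (of_omega k L) as [k' <-]. exists k'.
      apply val_inj. rewrite val_nadd, val_nsucc. exact M.
  - intros H. destruct (not_nlt_0 _ H).
  - intros c IH H. apply nlt_succ in H. destruct H as [H| ->].
    + destruct (IH H) as [k ->]. exists (nsucc k).
      rewrite !nadd_succ_r. reflexivity.
    + exists nzero. rewrite nadd_succ_r, nadd_0_r. reflexivity.
Qed.

Lemma nlt_add a b c : nlt a b -> nlt (nadd a c) (nadd b c).
Proof.
  rewrite !nlt_iff. intros [k ->]. exists k. ring.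
Qed.

Lemma nlt_add_cancel a b c : nlt (nadd a c) (nadd b c) -> nlt a b.
Proof.
  intros H. destruct (nlt_cases a b) as [K|[K|K]]; [exact K|..]; exfalso;
    apply (nlt_irrefl (nadd a c)).
  - rewrite <- K in H. exact H.
  - exact (nlt_trans _ _ _ H (nlt_add _ _ c K)).
Qed.

Lemma nlt_add2 a b c d : nlt a b -> nlt c d -> nlt (nadd a c) (nadd b d).
Proof.
  intros H K. apply nlt_trans with (nadd b c); [apply nlt_add, H|].
  rewrite (nadd_comm b c), (nadd_comm b d). apply nlt_add, K.
Qed.

Lemma nzero_or_succ a : a = nzero \/ exists k, a = nsucc k.
Proof.
  destruct (omega_cases _ (val_omega a)) as [H|(k & K & H)].
  - left. apply val_inj. rewrite val_nzero. exact H.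
  - right. destruct (of_omega k K) as [k' <-]. exists k'. apply val_inj.
    rewrite val_nsucc. exact H.
Qed.

Lemma nlt_mul a b c : c <> nzero -> nlt a b -> nlt (nmul a c) (nmul b c).
Proof.
  intros H. destruct (nzero_or_succ c) as [K|[c' ->]]; [contradiction|].
  rewrite !nlt_iff. intros [k ->].
  exists (nadd (nadd (nmul c' k) k) c'). rewrite !nsucc_eq. ring.
Qed.

Lemma nlt_mul_cancel a b c : nlt (nmul a c) (nmul b c) -> nlt a b.
Proof.
  intros H.
  assert (C : c <> nzero).
  { intros ->. rewrite !nmul_0_r in H. exact (nlt_irrefl _ H). }
  destruct (nlt_cases a b) as [K|[K|K]]; [exact K|..]; exfalso;
    apply (nlt_irrefl (nmul a c)).
  - rewrite <- K in H. exact H.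
  - exact (nlt_trans _ _ _ H (nlt_mul _ _ c C K)).
Qed.

Lemma nmul_neq_0 a b : a <> nzero -> b <> nzero -> nmul a b <> nzero.
Proof.
  intros H K. destruct (nzero_or_succ b) as [L|[k ->]]; [contradiction|].
  destruct (nzero_or_succ a) as [L|[m ->]]; [contradiction|].
  intros E. apply (not_nlt_0 (nmul (nsucc m) k)). rewrite <- E, nmul_succ_r.
  apply nlt_add_succ.
Qed.

Lemma nadd_neq_0 a b : a <> nzero -> nadd a b <> nzero.
Proof.
  intros H. destruct (nzero_or_succ a) as [L|[k ->]]; [contradiction|].
  intros E. apply (not_nlt_0 b). rewrite <- E, nadd_comm.
  apply nlt_add_succ.
Qed.

Lemma none_neq_0 : none <> nzero.
Proof.
  intros E. apply (not_nlt_0 nzero). rewrite <- E at 2. apply nlt_succ. tauto.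
Qed.

(** * Fractions *)

(** The fraction (a - b) / n. *)
Definition Fr (a b n : Nt) : V := frac (val a) (val b) (val n).

Implicit Types p q r : V.

Lemma frac_inj (a b n a' b' n' : V) :
  frac a b n = frac a' b' n' -> a = a' /\ b = b' /\ n = n'.
Proof.
  unfold frac. intros H. apply opair_inj in H. destruct H as [H ->].
  apply opair_inj in H. tauto.
Qed.

Lemma val_neq_empty n : val n <> empty <-> n <> nzero.
Proof.
  rewrite <- val_nzero. split; intros H K; apply H.
  - congruence.
  - apply val_inj, K.
Qed.

Lemma is_frac_Fr a b n : n <> nzero -> is_frac (Fr a b n) (val a) (val b) (val n).
Proof.
  intros H. repeat split; try apply val_omega. apply val_neq_empty, H.
Qed.

Lemma is_frac_inv q a b n : is_frac q a b n ->
  exists a' b' n', a = val a' /\ b = val b' /\ n = val n' /\ n' <> nzero /\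
    q = Fr a' b' n'.
Proof.
  intros (Ha & Hb & Hn & K & ->).
  destruct (of_omega a Ha) as [a' <-], (of_omega b Hb) as [b' <-],
    (of_omega n Hn) as [n' <-].
  exists a', b', n'. rewrite val_neq_empty in K. auto.
Qed.

Lemma Fr_inj a b n a' b' n' : Fr a b n = Fr a' b' n' -> a = a' /\ b = b' /\ n = n'.
Proof.
  intros H. apply frac_inj in H. destruct H as (H & K & L).
  apply val_inj in H, K, L. tauto.
Qed.

Lemma in_fracs q : q ∈ fracs <-> exists a b n, n <> nzero /\ q = Fr a b n.
Proof.
  unfold fracs. rewrite (in_setof (prod (prod omega omega) omega)).
  - split.
    + intros (a & b & n & H). apply is_frac_inv in H.
      destruct H as (a' & b' & n' & _ & _ & _ & H & ->). eauto.
    + intros (a & b & n & H & ->). exists (val a), (val b), (val n).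
      apply is_frac_Fr, H.
  - unfold is_frac. definable.
  - intros x (a & b & n & Ha & Hb & Hn & _ & ->). unfold frac.
    rewrite !opair_in_prod. tauto.
Qed.

Lemma Fr_in_fracs a b n : n <> nzero -> Fr a b n ∈ fracs.
Proof. intros H. apply in_fracs. eauto. Qed.

(** A relation between two fractions given by a relation between their
    numerators and denominators. *)
Lemma frac_rel_iff (R : V -> V -> V -> V -> V -> V -> Prop) a b n a' b' n' :
  n <> nzero -> n' <> nzero ->
  (exists x y z x' y' z', is_frac (Fr a b n) x y z /\ is_frac (Fr a' b' n') x' y' z'
    /\ R x y z x' y' z') <->
  R (val a) (val b) (val n) (val a') (val b') (val n').
Proof.
  intros H K. split.
  - intros (x & y & z & x' & y' & z' & L & M & N).
    apply is_frac_inv in L, M.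
    destruct L as (? & ? & ? & -> & -> & -> & _ & L),
      M as (? & ? & ? & -> & -> & -> & _ & M).
    apply Fr_inj in L, M. destruct L as (<- & <- & <-), M as (<- & <- & <-).
    exact N.
  - intros L. exists (val a), (val b), (val n), (val a'), (val b'), (val n').
    auto using is_frac_Fr.
Qed.

Lemma frac_lt_iff a b n a' b' n' : n <> nzero -> n' <> nzero ->
  frac_lt (Fr a b n) (Fr a' b' n') <->
  nlt (nadd (nmul a n') (nmul b' n)) (nadd (nmul a' n) (nmul b n')).
Proof.
  intros H K. unfold nlt. rewrite !val_nadd, !val_nmul.
  exact (frac_rel_iff (fun a b n a' b' n' =>
    nat_add (nat_mul a n') (nat_mul b' n) ∈
    nat_add (nat_mul a' n) (nat_mul b n')) a b n a' b' n' H K).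
Qed.

Lemma frac_eq_iff a b n a' b' n' : n <> nzero -> n' <> nzero ->
  frac_eq (Fr a b n) (Fr a' b' n') <->
  nadd (nmul a n') (nmul b' n) = nadd (nmul a' n) (nmul b n').
Proof.
  intros H K.
  transitivity (val (nadd (nmul a n') (nmul b' n)) =
                val (nadd (nmul a' n) (nmul b n'))).
  - rewrite !val_nadd, !val_nmul.
    exact (frac_rel_iff (fun a b n a' b' n' =>
      nat_add (nat_mul a n') (nat_mul b' n) =
      nat_add (nat_mul a' n) (nat_mul b n')) a b n a' b' n' H K).
  - split; [apply val_inj | congruence].
Qed.

Lemma frac_add_Fr a b n a' b' n' : n <> nzero -> n' <> nzero ->
  frac_add (Fr a b n) (Fr a' b' n') =
  Fr (nadd (nmul a n') (nmul a' n)) (nadd (nmul b n') (nmul b' n)) (nmul n n').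
Proof.
  intros H K.
  assert (E := fun r => frac_rel_iff (fun a b n a' b' n' =>
    r = frac (nat_add (nat_mul a n') (nat_mul a' n))
             (nat_add (nat_mul b n') (nat_mul b' n))
             (nat_mul n n')) a b n a' b' n' H K).
  unfold Fr at 3. rewrite !val_nadd, !val_nmul.
  apply the_eq; [apply E; reflexivity|]. intros r. apply E.
Qed.

Lemma frac_lt_fracs p q : frac_lt p q -> p ∈ fracs /\ q ∈ fracs.
Proof.
  intros (a & b & n & a' & b' & n' & H & K & _). apply is_frac_inv in H, K.
  destruct H as (? & ? & ? & _ & _ & _ & H & ->),
    K as (? & ? & ? & _ & _ & _ & K & ->).
  auto using Fr_in_fracs.
Qed.

Lemma frac_eq_fracs p q : frac_eq p q -> p ∈ fracs /\ q ∈ fracs.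
Proof.
  intros (a & b & n & a' & b' & n' & H & K & _). apply is_frac_inv in H, K.
  destruct H as (? & ? & ? & _ & _ & _ & H & ->),
    K as (? & ? & ? & _ & _ & _ & K & ->).
  auto using Fr_in_fracs.
Qed.

Lemma definable_frac_lt a b : definable_term a -> definable_term b ->
  definable (fun e : nat -> V => frac_lt (a e) (b e)).
Proof. apply definable_rel2. unfold frac_lt, is_frac. definable. Qed.

Lemma definable_frac_eq a b : definable_term a -> definable_term b ->
  definable (fun e : nat -> V => frac_eq (a e) (b e)).
Proof. apply definable_rel2. unfold frac_eq, is_frac. definable. Qed.

Lemma definable_frac_add a b : definable_term a -> definable_term b ->
  definable_term (fun e : nat -> V => frac_add (a e) (b e)).
Proof.
  apply definable_fun2. clear a b. unfold frac_add.
  apply (definable_the (fun r e => exists a b n a' b' n',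
    is_frac (e 0) a b n /\ is_frac (e 1) a' b' n' /\
    r = frac (nat_add (nat_mul a n') (nat_mul a' n))
             (nat_add (nat_mul b n') (nat_mul b' n))
             (nat_mul n n'))).
  - intros e x y (a & b & n & a' & b' & n' & H & K & ->)
      (c & d & m & c' & d' & m' & H' & K' & ->).
    destruct H as (_ & _ & _ & _ & H), K as (_ & _ & _ & _ & K),
      H' as (_ & _ & _ & _ & H'), K' as (_ & _ & _ & _ & K').
    rewrite H in H'. rewrite K in K'. apply frac_inj in H', K'.
    destruct H' as (-> & -> & ->), K' as (-> & -> & ->). reflexivity.
  - unfold is_frac. definable.
Qed.

Ltac definable_symbol ::= first
  [ definable_arithmetic | apply definable_frac_lt | apply definable_frac_eq
  | apply definable_frac_add ].

Lemma frac_trichotomy p q : p ∈ fracs -> q ∈ fracs ->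
  frac_lt p q \/ frac_eq p q \/ frac_lt q p.
Proof.
  intros H K. apply in_fracs in H, K.
  destruct H as (a & b & n & H & ->), K as (a' & b' & n' & K & ->).
  rewrite !frac_lt_iff, frac_eq_iff by assumption.
  rewrite (nadd_comm (nmul a' n)), (nadd_comm (nmul a n')).
  rewrite (nadd_comm (nmul b n')), (nadd_comm (nmul b' n)).
  apply nlt_cases.
Qed.

Lemma frac_lt_irrefl p : ~ frac_lt p p.
Proof.
  intros H. destruct (frac_lt_fracs _ _ H) as [K _]. apply in_fracs in K.
  destruct K as (a & b & n & K & ->). apply frac_lt_iff in H; [|assumption..].
  exact (nlt_irrefl _ H).
Qed.

Lemma frac_eq_sym p q : frac_eq p q -> frac_eq q p.
Proof.
  intros H. destruct (frac_eq_fracs _ _ H) as [K L]. apply in_fracs in K, L.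
  destruct K as (a & b & n & K & ->), L as (a' & b' & n' & L & ->).
  rewrite frac_eq_iff in * by assumption.
  rewrite nadd_comm, (nadd_comm (nmul a n')), (nadd_comm (nmul b n')).
  rewrite <- H. apply nadd_comm.
Qed.

(** The form in which inequalities between products are used: multiplying by [k]
    and adding [c] reflects the order. *)
Lemma nlt_scaled X Y X' Y' k c : nlt X' Y' ->
  nadd (nmul X k) c = X' -> nadd (nmul Y k) c = Y' -> nlt X Y.
Proof.
  intros H <- <-. exact (nlt_mul_cancel _ _ _ (nlt_add_cancel _ _ _ H)).
Qed.

(** In this comparison of three fractions and the next ones, each inequality is
    multiplied by the denominator of the remaining fraction; their sum is the
    conclusion multiplied by the middle denominator, up to a common term. *)
Lemma frac_lt_trans p q r : frac_lt p q -> frac_lt q r -> frac_lt p r.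
Proof.
  intros H K. destruct (frac_lt_fracs _ _ H) as [L M],
    (frac_lt_fracs _ _ K) as [_ N]. apply in_fracs in L, M, N.
  destruct L as (a & b & n & L & ->), M as (a' & b' & n' & M & ->),
    N as (c & d & m & N & ->).
  rewrite frac_lt_iff in * by assumption.
  apply (nlt_mul _ _ m N) in H. apply (nlt_mul _ _ n L) in K.
  apply (nlt_scaled _ _ _ _ n' (nmul (nmul n m) (nadd a' b'))
    (nlt_add2 _ _ _ _ H K)); ring.
Qed.

Lemma frac_eq_lt p q r : frac_eq p q -> frac_lt q r -> frac_lt p r.
Proof.
  intros H K. destruct (frac_eq_fracs _ _ H) as [L M],
    (frac_lt_fracs _ _ K) as [_ N]. apply in_fracs in L, M, N.
  destruct L as (a & b & n & L & ->), M as (a' & b' & n' & M & ->),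
    N as (c & d & m & N & ->).
  rewrite frac_lt_iff in * by assumption. rewrite frac_eq_iff in H by assumption.
  apply (nlt_mul _ _ n L) in K.
  apply (nlt_add _ _ (nmul (nadd (nmul a n') (nmul b' n)) m)) in K.
  apply (nlt_scaled _ _ _ _ n' (nmul (nmul n m) (nadd a' b')) K);
    [|rewrite H]; ring.
Qed.

Lemma frac_lt_eq p q r : frac_lt p q -> frac_eq q r -> frac_lt p r.
Proof.
  intros H K. destruct (frac_lt_fracs _ _ H) as [L M],
    (frac_eq_fracs _ _ K) as [_ N]. apply in_fracs in L, M, N.
  destruct L as (a & b & n & L & ->), M as (a' & b' & n' & M & ->),
    N as (c & d & m & N & ->).
  rewrite frac_lt_iff in * by assumption. rewrite frac_eq_iff in K by assumption.
  apply (nlt_mul _ _ m N) in H.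
  apply (nlt_add _ _ (nmul (nadd (nmul a' m) (nmul d n')) n)) in H.
  apply (nlt_scaled _ _ _ _ n' (nmul (nmul n m) (nadd a' b')) H);
    [|rewrite K]; ring.
Qed.

(** The mediant lies between two fractions. *)
Lemma frac_dense p q : frac_lt p q -> exists r, frac_lt p r /\ frac_lt r q.
Proof.
  intros H. destruct (frac_lt_fracs _ _ H) as [K L]. apply in_fracs in K, L.
  destruct K as (a & b & n & K & ->), L as (a' & b' & n' & L & ->).
  assert (M : nadd n n' <> nzero) by (apply nadd_neq_0, K).
  exists (Fr (nadd a a') (nadd b b') (nadd n n')).
  rewrite !frac_lt_iff in * by assumption. split.
  - apply (nlt_add _ _ (nmul n (nadd a b))) in H.
    apply (nlt_scaled _ _ _ _ none nzero H); ring.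
  - apply (nlt_add _ _ (nmul n' (nadd a' b'))) in H.
    apply (nlt_scaled _ _ _ _ none nzero H); ring.
Qed.

Lemma frac_below p : p ∈ fracs -> exists q, frac_lt q p.
Proof.
  intros H. apply in_fracs in H. destruct H as (a & b & n & H & ->).
  exists (Fr a (nadd b n) n). apply frac_lt_iff; [exact H..|].
  assert (K := nlt_mul _ _ n H (nlt_add_succ (nadd a b) nzero)).
  destruct (nzero_or_succ n) as [E|[k E]]; [contradiction|].
  rewrite (nadd_comm b n), nmul_add_l, nadd_assoc.
  apply nlt_add.
  assert (L := nlt_mul _ _ n H (nlt_add_succ nzero k)). rewrite <- E in L.
  apply (nlt_add _ _ (nmul a n)) in L.
  apply (nlt_scaled _ _ _ _ none nzero L); ring.
Qed.

Lemma frac_add_lt p q p' q' : frac_lt p p' -> frac_lt q q' ->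
  frac_lt (frac_add p q) (frac_add p' q').
Proof.
  intros H K. destruct (frac_lt_fracs _ _ H) as [L L'],
    (frac_lt_fracs _ _ K) as [M M']. apply in_fracs in L, L', M, M'.
  destruct L as (a & b & n & L & ->), L' as (a' & b' & n' & L' & ->),
    M as (c & d & m & M & ->), M' as (c' & d' & m' & M' & ->).
  rewrite !frac_add_Fr by assumption.
  rewrite frac_lt_iff in * by auto using nmul_neq_0.
  apply (nlt_mul _ _ (nmul m m')) in H; [|auto using nmul_neq_0].
  apply (nlt_mul _ _ (nmul n n')) in K; [|auto using nmul_neq_0].
  apply (nlt_scaled _ _ _ _ none nzero (nlt_add2 _ _ _ _ H K)); ring.
Qed.

Lemma frac_zero_Fr : (frac_zero : V) = Fr nzero nzero none.
Proof. reflexivity. Qed.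

(** The difference of two fractions, with its sign. *)
Lemma frac_sub p q : p ∈ fracs -> q ∈ fracs ->
  exists r, frac_eq q (frac_add p r) /\
    (frac_lt p q -> frac_lt frac_zero r) /\ (frac_lt q p -> frac_lt r frac_zero).
Proof.
  intros H K. apply in_fracs in H, K.
  destruct H as (a & b & n & H & ->), K as (a' & b' & n' & K & ->).
  exists (Fr (nadd (nmul a' n) (nmul b n')) (nadd (nmul b' n) (nmul a n'))
    (nmul n n')).
  assert (N : none <> nzero) by apply none_neq_0.
  rewrite frac_zero_Fr, frac_add_Fr by auto using nmul_neq_0.
  rewrite !frac_lt_iff, frac_eq_iff by auto using nmul_neq_0.
  split; [ring|]. split; intros L.
  - apply (nlt_scaled _ _ _ _ none nzero L); ring.
  - apply (nlt_scaled _ _ _ _ none nzero L); ring.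
Qed.

Lemma frac_half p : frac_lt frac_zero p ->
  exists r, frac_lt frac_zero r /\ frac_eq p (frac_add r r).
Proof.
  intros H. destruct (frac_lt_fracs _ _ H) as [_ K]. apply in_fracs in K.
  destruct K as (a & b & n & K & ->).
  assert (N : none <> nzero) by apply none_neq_0.
  exists (Fr a b (nadd n n)). rewrite frac_zero_Fr in *.
  rewrite frac_add_Fr by auto using nadd_neq_0.
  rewrite frac_lt_iff in * by auto using nadd_neq_0.
  rewrite frac_eq_iff by auto using nadd_neq_0, nmul_neq_0.
  split; [|ring]. apply (nlt_scaled _ _ _ _ none nzero H); ring.
Qed.

(** The fraction 1/n, for n <> 0. *)
Definition inv (n : V) : V := frac (succ empty) empty n.

Lemma inv_Fr n : inv (val n) = Fr none nzero n.
Proof. reflexivity. Qed.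

Lemma inv_pos n : n ∈ omega -> frac_lt frac_zero (inv (succ n)).
Proof.
  intros H. destruct (of_omega n H) as [m <-].
  rewrite <- val_nsucc, inv_Fr, frac_zero_Fr.
  assert (M : nsucc m <> nzero).
  { intros E. apply (not_nlt_0 m). rewrite <- E. apply nlt_succ. tauto. }
  apply frac_lt_iff; [apply none_neq_0|exact M|].
  assert (L := nlt_add_succ nzero nzero).
  apply (nlt_scaled _ _ _ _ none nzero L); rewrite !nsucc_eq; ring.
Qed.

Lemma inv_anti n m : n ∈ omega -> m ∈ omega -> n ∈ m ->
  frac_lt (inv (succ m)) (inv (succ n)).
Proof.
  intros Hn Hm. destruct (of_omega n Hn) as [a <-], (of_omega m Hm) as [b <-].
  intros H. rewrite <- !val_nsucc, !inv_Fr.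
  apply frac_lt_iff; [rewrite nsucc_eq, nadd_comm; apply nadd_neq_0, none_neq_0..|].
  change (nlt a b) in H. apply (nlt_add _ _ none) in H.
  apply (nlt_scaled _ _ _ _ none nzero H); rewrite ?nsucc_eq; ring.
Qed.

Lemma frac_archimedean p : frac_lt frac_zero p ->
  exists n, n ∈ omega /\ frac_lt (inv (succ n)) p.
Proof.
  intros H. destruct (frac_lt_fracs _ _ H) as [_ K]. apply in_fracs in K.
  destruct K as (a & b & n & K & ->).
  exists (val n). split; [apply val_omega|].
  rewrite <- val_nsucc, inv_Fr. rewrite frac_zero_Fr in H.
  apply frac_lt_iff in H; [|apply none_neq_0|exact K].
  assert (M : nsucc n <> nzero)
    by (rewrite nsucc_eq, nadd_comm; apply nadd_neq_0, none_neq_0).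
  apply frac_lt_iff; [exact M | exact K |].
  assert (L : nlt b a) by (apply (nlt_scaled _ _ _ _ none nzero H); ring).
  apply nlt_iff in L. destruct L as [k ->].
  (* (b + k + 1)(n + 1) exceeds n + b(n + 1) by k(n + 1) + 1. *)
  apply nlt_iff. exists (nmul k (nsucc n)). rewrite !nsucc_eq. ring.
Qed.

(** * Real numbers *)

Implicit Types u v w : V.

(** The cut of a rational number. *)
Definition below q : V := setof (fun p => frac_lt p q).

Lemma in_below p q : p ∈ below q <-> frac_lt p q.
Proof.
  apply (in_setof fracs (fun p => frac_lt p q)); [definable|].
  intros x. apply frac_lt_fracs.
Qed.

Lemma in_reals u : u ∈ reals <-> cut u.
Proof.
  apply (in_setof (power fracs) cut); [unfold cut; definable|].
  intros x [H _]. apply in_power, H.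
Qed.

Lemma below_cut q : q ∈ fracs -> cut (below q).
Proof.
  intros H. repeat apply conj.
  - intros p K. apply in_below, frac_lt_fracs in K. tauto.
  - destruct (frac_below q H) as [p K]. exists p. apply in_below, K.
  - exists q. split; [exact H|]. rewrite in_below. apply frac_lt_irrefl.
  - intros p r K L. apply in_below. apply in_below in K.
    exact (frac_lt_trans _ _ _ L K).
  - intros p K. apply in_below, frac_dense in K. destruct K as (r & K & L).
    exists r. split; [apply in_below, L | exact K].
Qed.

Lemma cut_fracs u p : cut u -> p ∈ u -> p ∈ fracs.
Proof. intros H. apply (proj1 H). Qed.

Lemma cut_down u p q : cut u -> q ∈ u -> frac_lt p q -> p ∈ u.
Proof. intros (_ & _ & _ & H & _). apply H. Qed.

Lemma cut_up u p : cut u -> p ∈ u -> exists q, q ∈ u /\ frac_lt p q.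
Proof. intros (_ & _ & _ & _ & H). apply H. Qed.

(** A fraction outside a cut exceeds all its elements, strictly because a cut has
    no greatest element. *)
Lemma cut_lt u p q : cut u -> p ∈ u -> q ∈ fracs -> q ∉ u -> frac_lt p q.
Proof.
  intros C H K L. destruct (cut_up u p C H) as (p' & H' & M).
  destruct (frac_trichotomy p' q (cut_fracs _ _ C H') K) as [N|[N|N]].
  - exact (frac_lt_trans _ _ _ M N).
  - exact (frac_lt_eq _ _ _ M N).
  - destruct (L (cut_down _ _ _ C H' N)).
Qed.

Lemma not_subset u v : ~ subset u v -> exists q, q ∈ u /\ q ∉ v.
Proof.
  intros H. apply NNPP. intros K. apply H. intros q L. apply NNPP. intros M.
  eauto.
Qed.

Lemma cut_total u v : cut u -> cut v -> subset u v \/ subset v u.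
Proof.
  intros C D. destruct (classic (subset u v)) as [H|H]; [tauto|].
  right. destruct (not_subset _ _ H) as (q & K & L). intros p M.
  apply (cut_down u p q C K), (cut_lt v p q D M); [|exact L].
  exact (cut_fracs _ _ C K).
Qed.

Lemma real_lt_witness u v : real_lt u v -> exists q, q ∈ v /\ q ∉ u.
Proof.
  intros [H K]. apply not_subset. intros L. apply K, subset_antisym; assumption.
Qed.

Lemma real_lt_le_trans u v w : real_lt u v -> subset v w -> real_lt u w.
Proof.
  intros [H K] L. split.
  - intros x M. apply L, H, M.
  - intros ->. apply K, subset_antisym; assumption.
Qed.

Lemma below_real_lt u q : cut u -> q ∈ u -> real_lt (below q) u.
Proof.
  intros C H. split.
  - intros p K. apply in_below in K. exact (cut_down _ _ _ C H K).
  - intros E. rewrite <- E in H. apply in_below in H.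
    exact (frac_lt_irrefl _ H).
Qed.

Lemma frac_zero_fracs : frac_zero ∈ (fracs : V).
Proof.
  apply in_fracs. exists nzero, nzero, none.
  split; [apply none_neq_0 | apply frac_zero_Fr].
Qed.

Lemma real_zero_below : real_zero = below frac_zero.
Proof. reflexivity. Qed.

Lemma zero_lt_below q : frac_lt frac_zero q -> real_lt real_zero (below q).
Proof.
  intros H. rewrite real_zero_below. apply below_real_lt.
  - apply below_cut. apply (frac_lt_fracs _ _ H).
  - apply in_below, H.
Qed.

Lemma real_pos_witness u :
  cut u -> real_lt real_zero u -> exists q, q ∈ u /\ frac_lt frac_zero q.
Proof.
  intros C H. rewrite real_zero_below in H.
  destruct (real_lt_witness _ _ H) as (p & K & L).
  destruct (cut_up u p C K) as (q & M & N). exists q. split; [exact M|].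
  destruct (frac_trichotomy frac_zero q frac_zero_fracs (cut_fracs _ _ C M))
    as [P|[P|P]]; [exact P|exfalso; apply L, in_below..].
  - exact (frac_lt_eq _ _ _ N (frac_eq_sym _ _ P)).
  - exact (frac_lt_trans _ _ _ N P).
Qed.

Lemma in_real_add u v r : r ∈ real_add u v <->
  exists p q, p ∈ u /\ q ∈ v /\ frac_eq r (frac_add p q).
Proof.
  apply (in_setof fracs (fun r => exists p q, p ∈ u /\ q ∈ v /\
    frac_eq r (frac_add p q))); [definable|].
  intros x (p & q & _ & _ & H). apply (frac_eq_fracs _ _ H).
Qed.

Lemma frac_add_comm p q : p ∈ fracs -> q ∈ fracs -> frac_add p q = frac_add q p.
Proof.
  intros H K. apply in_fracs in H, K.
  destruct H as (a & b & n & H & ->), K as (a' & b' & n' & K & ->).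
  rewrite !frac_add_Fr by assumption. f_equal; ring.
Qed.

Lemma real_le_add_l u v : cut u -> real_le real_zero v -> subset u (real_add u v).
Proof.
  intros C H p K. destruct (cut_up u p C K) as (q & L & M).
  destruct (frac_lt_fracs _ _ M) as [N P].
  destruct (frac_sub q p P N) as (r & E & _ & Q).
  apply in_real_add. exists q, r. split; [exact L|]. split; [|exact E].
  apply H. rewrite real_zero_below. apply in_below, Q, M.
Qed.

Lemma real_le_add_r u v : cut u -> cut v -> real_le real_zero v ->
  subset u (real_add v u).
Proof.
  intros C D H p K. apply (real_le_add_l u v C H) in K.
  apply in_real_add in K. destruct K as (q & r & K & L & M).
  apply in_real_add. exists r, q. split; [exact L|]. split; [exact K|].
  rewrite frac_add_comm; [exact M | exact (cut_fracs _ _ D L) |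
    exact (cut_fracs _ _ C K)].
Qed.

(** * Metric spaces *)

Implicit Types X Y d t x y z A B C U W F : V.

Lemma dist_real X d x y : metric X d -> x ∈ X -> y ∈ X -> dist d x y ∈ reals.
Proof.
  intros M H K. apply (app_in _ _ _ _ (proj1 M)), opair_in_prod. tauto.
Qed.

Lemma dist_cut X d x y : metric X d -> x ∈ X -> y ∈ X -> cut (dist d x y).
Proof. intros M H K. apply in_reals. eapply dist_real; eassumption. Qed.

Lemma dist_refl X d x : metric X d -> x ∈ X -> dist d x x = real_zero.
Proof. intros (_ & _ & M & _) H. apply M; auto. Qed.

Lemma in_ball X d x r y : metric X d ->
  y ∈ ball X d x r <-> y ∈ X /\ real_lt (dist d x y) r.
Proof.
  intros M. assert (D := proj1 M).
  apply (in_setof X (fun y => y ∈ X /\ real_lt (dist d x y) r)); [|tauto].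
  unfold real_lt, real_le, dist. definable.
Qed.

Lemma definable_ball X d a b : metric X d ->
  definable_term a -> definable_term b ->
  definable_term (fun e => ball X d (a e) (b e)).
Proof.
  intros M. assert (D := proj1 M). apply definable_fun2.
  unfold ball, real_lt, real_le, dist. definable.
Qed.

Lemma in_metric_topology X d U : metric X d ->
  U ∈ metric_topology X d <->
  subset U X /\ forall x, x ∈ U ->
    exists r, r ∈ reals /\ real_lt real_zero r /\ subset (ball X d x r) U.
Proof.
  intros M. apply (in_setof (power X) (fun U => subset U X /\ forall x, x ∈ U ->
    exists r, r ∈ reals /\ real_lt real_zero r /\ subset (ball X d x r) U)).
  - unfold real_lt, real_le. definable. apply (definable_ball X d _ _ M); definable.
  - intros W H. apply in_power, H.
Qed.

Lemma ball_center X d x r :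
  metric X d -> x ∈ X -> real_lt real_zero r -> x ∈ ball X d x r.
Proof.
  intros M H K. apply (in_ball X d x r x M). split; [exact H|].
  rewrite (dist_refl X d x M H). exact K.
Qed.

Lemma ball_subset X d x r s :
  metric X d -> subset r s -> subset (ball X d x r) (ball X d x s).
Proof.
  intros M H y. rewrite !in_ball by exact M. intros [K L].
  split; [exact K | exact (real_lt_le_trans _ _ _ L H)].
Qed.

(** The triangle inequality for rational upper bounds. *)
Lemma dist_triangle_lt X d x y z p q q' : metric X d ->
  x ∈ X -> y ∈ X -> z ∈ X ->
  (forall p, p ∈ dist d x y -> frac_lt p q) ->
  (forall p, p ∈ dist d y z -> frac_lt p q') ->
  p ∈ dist d x z -> frac_lt p (frac_add q q').
Proof.
  intros M Hx Hy Hz H K L.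
  apply (proj2 (proj2 (proj2 (proj2 M))) x y z Hx Hy Hz) in L.
  apply in_real_add in L. destruct L as (p1 & p2 & L1 & L2 & E).
  apply (frac_eq_lt _ _ _ E), frac_add_lt; auto.
Qed.

(** A ball contains a ball around each of its points. *)
Lemma ball_inner X d x r y : metric X d -> x ∈ X -> r ∈ reals ->
  y ∈ ball X d x r ->
  exists s, s ∈ reals /\ real_lt real_zero s /\ subset (ball X d y s) (ball X d x r).
Proof.
  intros M Hx Hr H. apply in_reals in Hr. apply (in_ball X d x r y M) in H.
  destruct H as [Hy H]. assert (C := dist_cut X d x y M Hx Hy).
  destruct (real_lt_witness _ _ H) as (q & K & L).
  destruct (cut_up r q Hr K) as (q' & K' & N).
  destruct (frac_lt_fracs _ _ N) as [P P'].
  (* The radius is the gap q' - q between two rationals q < q' with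
     d(x, y) <= q and q' < r. *)
  destruct (frac_sub q q' P P') as (e & E & Q & _). specialize (Q N).
  exists (below e). split; [|split].
  - apply in_reals, below_cut, (frac_lt_fracs _ _ Q).
  - apply zero_lt_below, Q.
  - intros z S. apply (in_ball X d y _ z M) in S. destruct S as [Hz [S _]].
    assert (T : forall p, p ∈ dist d x z -> frac_lt p q').
    { intros p T. apply frac_lt_eq with (frac_add q e); [|apply frac_eq_sym, E].
      apply (dist_triangle_lt X d x y z p q e M Hx Hy Hz); [| |exact T].
      - intros p' G. exact (cut_lt _ _ _ C G P L).
      - intros p' G. apply in_below, S, G. }
    apply (in_ball X d x r z M). split; [exact Hz|]. split.
    + intros p G. apply (cut_down r p q' Hr K'), T, G.
    + intros G. apply (frac_lt_irrefl q'), T. rewrite G. exact K'.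
Qed.

Lemma ball_open X d x r :
  metric X d -> x ∈ X -> r ∈ reals -> ball X d x r ∈ metric_topology X d.
Proof.
  intros M Hx Hr. apply (in_metric_topology X d _ M). split.
  - intros y H. apply (in_ball X d x r y M) in H. tauto.
  - intros y H. apply ball_inner; assumption.
Qed.

Lemma metric_topology_spec X d : metric X d -> topology X (metric_topology X d).
Proof.
  intros M. assert (T := fun U => in_metric_topology X d U M).
  repeat apply conj.
  - intros U H. apply T in H. apply in_power. tauto.
  - apply T. split; intros x H; destruct (in_empty _ H).
  - apply T. split; [intros x H; exact H|]. intros x H.
    assert (P := inv_pos empty omega_0).
    exists (below (inv (succ empty))). split; [|split].
    + apply in_reals, below_cut, (frac_lt_fracs _ _ P).
    + apply zero_lt_below, P.
    + intros y K. apply (in_ball X d x _ y M) in K. tauto.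
  - intros U W HU HW. apply T in HU, HW. apply T. split.
    + intros x H. apply in_inter in H. apply HU. tauto.
    + intros x H. apply in_inter in H. destruct H as [H K].
      destruct (proj2 HU x H) as (r & R1 & R2 & R3).
      destruct (proj2 HW x K) as (s & S1 & S2 & S3).
      (* The smaller of the two radii. *)
      destruct (cut_total r s) as [L|L]; [apply in_reals; assumption..| |].
      * exists r. split; [exact R1|]. split; [exact R2|]. intros y N.
        apply in_inter. split; [apply R3, N|].
        apply S3, (ball_subset X d x r s M L), N.
      * exists s. split; [exact S1|]. split; [exact S2|]. intros y N.
        apply in_inter. split; [|apply S3, N].
        apply R3, (ball_subset X d x s r M L), N.
  - intros F H. apply T. split.
    + intros x K. apply in_union in K. destruct K as (U & K & L).
      apply H, T in K. apply K, L.
    + intros x K. apply in_union in K. destruct K as (U & K & L).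
      destruct (proj2 (proj1 (T U) (H U K)) x L) as (r & R1 & R2 & R3).
      exists r. split; [exact R1|]. split; [exact R2|]. intros y N.
      apply in_union. exists U. auto.
Qed.

Lemma metrizable_hausdorff X t : metrizable X t -> hausdorff X t.
Proof.
  intros (d & M & ->) x y Hx Hy N.
  assert (C := dist_cut X d x y M Hx Hy).
  assert (D : real_lt real_zero (dist d x y)).
  { split; [apply M; assumption|]. intros E. apply N. symmetry in E. revert E.
    apply M; assumption. }
  destruct (real_pos_witness _ C D) as (q & H & K).
  (* With 0 < q < d(x, y), the balls of radius q/2 are disjoint. *)
  destruct (frac_half q K) as (e & P & E).
  assert (R : below e ∈ reals) by apply in_reals, below_cut, (frac_lt_fracs _ _ P).
  assert (R' := zero_lt_below e P).
  exists (ball X d x (below e)), (ball X d y (below e)).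
  split; [apply ball_open; assumption|].
  split; [apply ball_open; assumption|].
  split; [apply ball_center; assumption|].
  split; [apply ball_center; assumption|].
  destruct (empty_or_inhabited (inter (ball X d x (below e)) (ball X d y (below e))))
    as [G|[z G]]; [exact G|]. exfalso.
  apply in_inter in G. rewrite !in_ball in G by exact M.
  destruct G as [[Hz [G _]] [_ [G' _]]].
  rewrite (proj1 (proj2 (proj2 (proj2 M))) y z Hy Hz) in G'.
  apply (frac_lt_irrefl q).
  apply frac_lt_eq with (frac_add e e); [|apply frac_eq_sym, E].
  apply (dist_triangle_lt X d x z y q e e M Hx Hz Hy); [| |exact H].
  - intros p L. apply in_below, G, L.
  - intros p L. apply in_below, G', L.
Qed.

(** A set whose elements can be told apart by natural numbers is countable. *)
Lemma countable_coded B (R : V -> V -> Prop) :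
  definable (fun e => R (e 0) (e 1)) ->
  (forall x, x ∈ B -> exists n, n ∈ omega /\ R x n) ->
  (forall x y n, x ∈ B -> y ∈ B -> R x n -> R y n -> x = y) ->
  countable B.
Proof.
  intros D H K.
  destruct (exists_func B omega
    (fun x n => R x n /\ forall m, m ∈ n -> ~ R x m)) as (f & F & L).
  - definable; apply (definable_rel2 R); (exact D || definable).
  - intros x Hx. destruct (omega_least (R x)) as (n & Hn & A1 & A2).
    + apply (definable_rel2 R); [exact D|definable..].
    + apply H, Hx.
    + exists n. split; [tauto|]. intros m (Hm & B1 & B2).
      exact (least_unique (R x) n m Hn Hm A1 A2 B1 B2).
  - assert (S : forall n, n ∈ setof (fun n => exists x, x ∈ B /\ app f x = n) <->
      exists x, x ∈ B /\ app f x = n).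
    { apply (in_setof omega (fun n => exists x, x ∈ B /\ app f x = n)).
      - definable.
      - intros n (x & Hx & <-). exact (app_in _ _ _ _ F Hx). }
    set (I := setof _) in S. clearbody I. exists I. split.
    + intros n N. apply S in N. destruct N as (x & Hx & <-).
      exact (app_in _ _ _ _ F Hx).
    + exists f. split; [|split].
      * split; [|apply F]. intros p P. assert (Q := proj1 F p P).
        apply in_prod in Q. destruct Q as (x & n & Hx & Hn & ->).
        apply opair_in_prod. split; [exact Hx|]. apply S. exists x.
        split; [exact Hx|]. apply (func_eq f B omega x n F P).
      * intros x y Hx Hy E. apply (K x y (app f x) Hx Hy).
        -- apply L, Hx.
        -- rewrite E. apply L, Hy.
      * intros n N. apply S, N.
Qed.

Lemma metrizable_first_countable X t : metrizable X t -> first_countable X t.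
Proof.
  intros (d & M & ->) x Hx.
  (* The balls of radius 1/(n + 1) form a base at x. *)
  set (b := fun n => ball X d x (below (inv (succ n)))).
  assert (Db : forall a, definable_term a -> definable_term (fun e => b (a e))).
  { intros a. apply (definable_fun1 b). apply definable_eq; [definable|].
    unfold b. apply (definable_ball X d _ _ M); [definable|].
    unfold below, inv. definable. }
  assert (Hb : forall n, n ∈ omega -> b n ∈ metric_topology X d /\ x ∈ b n).
  { intros n Hn. assert (P := inv_pos n Hn). split.
    - apply ball_open; [exact M | exact Hx |].
      apply in_reals, below_cut, (frac_lt_fracs _ _ P).
    - apply ball_center; [exact M | exact Hx |]. apply zero_lt_below, P. }
  assert (S : forall U, U ∈ setof (fun U => exists n, n ∈ omega /\ U = b n) <->
    exists n, n ∈ omega /\ U = b n).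
  { apply (in_setof (metric_topology X d)
      (fun U => exists n, n ∈ omega /\ U = b n)).
    - definable. apply Db. definable.
    - intros U (n & Hn & ->). apply Hb, Hn. }
  set (B := setof _) in S. clearbody B. exists B. split; [|split; [|split]].
  - intros U H. apply S in H. destruct H as (n & Hn & ->). apply Hb, Hn.
  - apply (countable_coded B (fun U n => U = b n)).
    + definable. apply Db. definable.
    + intros U H. apply S, H.
    + intros U W n _ _ -> ->. reflexivity.
  - intros U H. apply S in H. destruct H as (n & Hn & ->). apply Hb, Hn.
  - intros U H K. apply (in_metric_topology X d U M) in H.
    destruct (proj2 H x K) as (r & R1 & R2 & R3). apply in_reals in R1.
    destruct (real_pos_witness r R1 R2) as (q & Q & P).
    destruct (frac_archimedean q P) as (n & Hn & L).
    exists (b n). split; [apply S; eauto|].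
    intros y N. apply R3. revert y N. apply ball_subset; [exact M|].
    intros p N. apply in_below in N.
    exact (cut_down _ _ _ R1 Q (frac_lt_trans _ _ _ N L)).
Qed.

(** * Sequential spaces and Fréchet-Urysohn spaces *)

Implicit Types f g h k m n : V.

Lemma in_closure X t A x : x ∈ closure X t A <->
  x ∈ X /\ forall C, closed X t C -> subset A C -> x ∈ C.
Proof.
  apply (in_setof X (fun x => x ∈ X /\
    forall C, closed X t C -> subset A C -> x ∈ C)); [|tauto].
  unfold closed. definable.
Qed.

Lemma diff_diff X A : subset A X -> diff X (diff X A) = A.
Proof.
  intros H. apply set_ext. intros x. rewrite !in_diff. split.
  - intros [K L]. apply NNPP. tauto.
  - intros K. split; [apply H, K | tauto].
Qed.

Lemma open_subset X t U : topology X t -> U ∈ t -> subset U X.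
Proof. intros T H. apply in_power, T, H. Qed.

Lemma closure_meets X t A x U : topology X t -> subset A X ->
  x ∈ closure X t A -> U ∈ t -> x ∈ U -> exists a, a ∈ A /\ a ∈ U.
Proof.
  intros T HA Hx HU K. apply NNPP. intros N.
  apply in_closure in Hx. destruct Hx as [_ Hx].
  assert (L : x ∈ diff X U).
  { apply Hx.
    - split; [intros y Hy; apply in_diff in Hy; tauto|].
      rewrite diff_diff; [exact HU | exact (open_subset _ _ _ T HU)].
    - intros a Ha. apply in_diff. split; [apply HA, Ha|]. eauto. }
  apply in_diff in L. tauto.
Qed.

Lemma closed_sequentially_closed X t A :
  closed X t A -> sequentially_closed X t A.
Proof.
  intros [H K]. split; [exact H|]. intros s x S [Hx C]. apply NNPP. intros N.
  destruct (C (diff X A) K) as (m & Hm & L); [apply in_diff; tauto|].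
  specialize (L m Hm (or_intror eq_refl)). apply in_diff in L.
  apply L. exact (app_in _ _ _ _ S Hm).
Qed.

Lemma frechet_urysohn_sequential X t :
  topology X t -> frechet_urysohn X t -> sequential X t.
Proof.
  intros T FU A. split; [|apply closed_sequentially_closed].
  intros [H K]. split; [exact H|].
  assert (S : forall U, U ∈ setof (fun U => U ∈ t /\ forall a, a ∈ A -> a ∉ U) <->
    U ∈ t /\ forall a, a ∈ A -> a ∉ U).
  { apply (in_setof t (fun U => U ∈ t /\ forall a, a ∈ A -> a ∉ U));
      [definable | tauto]. }
  set (F := setof _) in S. clearbody F.
  (* Points outside A are outside its closure, so the complement of A is the
     union of the open sets disjoint from A. *)
  replace (diff X A) with (union F).
  - apply T. intros U L. apply S in L. tauto.
  - apply set_ext. intros x. rewrite in_union, in_diff. split.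
    + intros (U & L & M). apply S in L. destruct L as [L L'].
      split; [exact (open_subset _ _ _ T L x M)|]. intros N. exact (L' x N M).
    + intros [Hx N]. apply NNPP. intros L.
      assert (M : x ∈ closure X t A).
      { apply in_closure. split; [exact Hx|]. intros C [C1 C2] C3.
        apply NNPP. intros C4. apply L. exists (diff X C). split.
        - apply S. split; [exact C2|]. intros a Ha. rewrite in_diff.
          intros [_ C5]. apply C5, C3, Ha.
        - apply in_diff. tauto. }
      destruct (FU A x H M) as (s & s1 & s2). apply N. exact (K s x s1 s2).
Qed.

Lemma in_subspace t Y W : W ∈ subspace t Y <-> exists U, U ∈ t /\ W = inter U Y.
Proof.
  apply (in_setof (power Y) (fun W => exists U, U ∈ t /\ W = inter U Y));
    [definable|].
  intros x (U & _ & ->). apply in_power. intros y H. apply in_inter in H. tauto.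
Qed.

Lemma subspace_topology X t Y :
  topology X t -> subset Y X -> topology Y (subspace t Y).
Proof.
  intros T H. assert (T' := T). destruct T' as (T1 & T2 & T3 & T4 & T5).
  repeat apply conj.
  - intros W K. apply in_subspace in K. destruct K as (U & K & ->).
    apply in_power. intros y L. apply in_inter in L. tauto.
  - apply in_subspace. exists empty. split; [exact T2|]. apply set_ext.
    intros x. rewrite in_inter. split; [intros K; destruct (in_empty _ K) | tauto].
  - apply in_subspace. exists X. split; [exact T3|]. apply set_ext.
    intros x. rewrite in_inter. split; [|tauto]. intros K.
    split; [apply H, K | exact K].
  - intros U W K L. apply in_subspace in K, L.
    destruct K as (U' & K & ->), L as (W' & L & ->). apply in_subspace.
    exists (inter U' W'). split; [apply T4; assumption|]. apply set_ext.
    intros x. rewrite !in_inter. tauto.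
  - intros F K.
    assert (S : forall U, U ∈ setof (fun U => U ∈ t /\ inter U Y ∈ F) <->
      U ∈ t /\ inter U Y ∈ F).
    { apply (in_setof t (fun U => U ∈ t /\ inter U Y ∈ F)); [definable | tauto]. }
    set (G := setof _) in S. clearbody G.
    apply in_subspace. exists (union G). split.
    + apply T5. intros U L. apply S in L. tauto.
    + apply set_ext. intros x. rewrite in_inter, !in_union. split.
      * intros (W & L & M). assert (N := K W L). apply in_subspace in N.
        destruct N as (U & N & ->). apply in_inter in M. split; [|tauto].
        exists U. rewrite S. tauto.
      * intros [(U & L & M) N]. apply S in L. exists (inter U Y).
        rewrite in_inter. tauto.
Qed.

Lemma subspace_frechet_urysohn X t Y : topology X t -> subset Y X ->
  frechet_urysohn X t -> frechet_urysohn Y (subspace t Y).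
Proof.
  intros T H FU A x K L. apply in_closure in L. destruct L as [Hx L].
  destruct (FU A x) as (s & s1 & _ & s2).
  - intros y M. apply H, K, M.
  - apply in_closure. split; [apply H, Hx|]. intros C [C1 C2] C3.
    assert (M : x ∈ inter C Y).
    { apply L.
      - split; [intros y M; apply in_inter in M; tauto|].
        apply in_subspace. exists (diff X C). split; [exact C2|].
        apply set_ext. intros y. rewrite in_diff, !in_inter, in_diff.
        specialize (H y). tauto.
      - intros y M. apply in_inter. split; [apply C3, M | apply K, M]. }
    apply in_inter in M. tauto.
  - exists s. split; [exact s1|]. split; [exact Hx|]. intros W M N.
    apply in_subspace in M. destruct M as (U & M & ->). apply in_inter in N.
    destruct (s2 U M (proj1 N)) as (m & Hm & P). exists m. split; [exact Hm|].
    intros n Hn Q. apply in_inter. split; [apply P; assumption|].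
    apply K. exact (app_in _ _ _ _ s1 Hn).
Qed.

Lemma frechet_urysohn_hereditarily_sequential X t :
  topology X t -> frechet_urysohn X t -> hereditarily_sequential X t.
Proof.
  intros T FU Y H. apply frechet_urysohn_sequential.
  - exact (subspace_topology X t Y T H).
  - exact (subspace_frechet_urysohn X t Y T H FU).
Qed.

Lemma subspace_self X t : topology X t -> subspace t X = t.
Proof.
  intros T. apply set_ext. intros W. rewrite in_subspace.
  assert (E : forall U, U ∈ t -> inter U X = U).
  { intros U H. apply set_ext. intros x. rewrite in_inter. split; [tauto|].
    intros K. split; [exact K | exact (open_subset _ _ _ T H x K)]. }
  split.
  - intros (U & H & ->). rewrite E; exact H.
  - intros H. exists W. split; [exact H | symmetry; apply E, H].
Qed.

Lemma hereditarily_sequential_sequential X t :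
  topology X t -> hereditarily_sequential X t -> sequential X t.
Proof.
  intros T H. rewrite <- (subspace_self X t T). apply H. intros x K. exact K.
Qed.

(** * Countable choice makes first-countable spaces Fréchet-Urysohn *)

(** There is no injection of ω into a natural number. *)
Lemma no_injection_omega m : m ∈ omega ->
  forall g, func g omega m -> exists x y, x ∈ omega /\ y ∈ omega /\ x <> y /\
    exists z, opair x z ∈ g /\ opair y z ∈ g.
Proof.
  apply (omega_ind (fun m => forall g, func g omega m ->
    exists x y, x ∈ omega /\ y ∈ omega /\ x <> y /\
      exists z, opair x z ∈ g /\ opair y z ∈ g)); [definable| |].
  - intros g G. destruct (in_empty _ (app_in _ _ _ _ G omega_0)).
  - clear m. intros m Hm IH g G. apply NNPP. intros N.
    assert (I : forall x y, x ∈ omega -> y ∈ omega -> app g x = app g y -> x = y).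
    { intros x y Hx Hy E. apply NNPP. intros K. apply N. exists x, y.
      repeat (split; [assumption|]). exists (app g x).
      split; [|rewrite E]; apply (func_app g omega (succ m)); assumption. }
    clear N.
    (* Dropping the argument 0, whose value replaces m, gives an injection
       into m. *)
    assert (B : forall x, x ∈ omega -> app g x <> m -> app g x ∈ m).
    { intros x Hx K. apply (app_in _ _ _ _ G), in_succ in Hx. tauto. }
    assert (B0 : forall x, x ∈ omega -> app g (succ x) = m -> app g empty <> m).
    { intros x Hx K L. rewrite <- K in L. apply I in L; auto with omega.
      exact (succ_neq_0 x (eq_sym L)). }
    destruct (exists_func omega m (fun x y =>
      (app g (succ x) <> m /\ y = app g (succ x)) \/
      (app g (succ x) = m /\ y = app g empty))) as (h & H & K).
    + definable.
    + intros x Hx. destruct (classic (app g (succ x) = m)) as [E|E].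
      * exists (app g empty). split.
        -- split; [|tauto]. apply B; auto with omega. exact (B0 x Hx E).
        -- intros y. tauto || intuition congruence.
      * exists (app g (succ x)). split.
        -- split; [|tauto]. apply B; auto with omega.
        -- intros y. intuition congruence.
    + destruct (IH h H) as (x & y & Hx & Hy & D & z & L & M). apply D.
      apply (func_eq h omega m) in L, M; [|exact H..].
      destruct L as (_ & _ & L), M as (_ & _ & M).
      assert (Kx := K x Hx). assert (Ky := K y Hy). rewrite L in Kx. rewrite M in Ky.
      clear K L M. apply (succ_inj x y Hy).
      destruct Kx as [[Kx ->]|[Kx ->]], Ky as [[Ky E]|[Ky E]].
      * apply I; auto with omega.
      * apply I in E; auto with omega. destruct (succ_neq_0 _ E).
      * apply I in E; auto with omega. destruct (succ_neq_0 _ (eq_sym E)).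
      * apply I; auto with omega. congruence.
Qed.

(** Countable choice for relations; the sets to choose from are made distinct,
    hence infinitely many, by labelling their elements. *)
Lemma CAC_relation A (R : V -> V -> Prop) : CAC V ->
  definable (fun e => R (e 0) (e 1)) ->
  (forall n, n ∈ omega -> exists a, a ∈ A /\ R n a) ->
  exists s, func s omega A /\ forall n, n ∈ omega -> R n (app s n).
Proof.
  intros AC D H.
  set (G := fun n => setof (fun p => exists a, a ∈ A /\ p = opair n a /\ R n a)).
  assert (HG : forall n, n ∈ omega ->
    forall p, p ∈ G n <-> exists a, a ∈ A /\ p = opair n a /\ R n a).
  { intros n Hn. apply (in_setof (prod omega A)
      (fun p => exists a, a ∈ A /\ p = opair n a /\ R n a)).
    - definable. apply (definable_rel2 R _ _ D); definable.
    - intros p (a & Ha & -> & _). apply opair_in_prod. tauto. }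
  assert (DG : forall a, definable_term a -> definable_term (fun e => G (a e))).
  { intros a. apply (definable_fun1 G). unfold G. definable.
    apply (definable_rel2 R _ _ D); definable. }
  assert (inj : forall n m, n ∈ omega -> m ∈ omega -> G n = G m -> n = m).
  { intros n m Hn Hm E. destruct (H n Hn) as (a & Ha & K).
    assert (L : opair n a ∈ G m) by (rewrite <- E; apply HG; eauto).
    apply HG in L; [|exact Hm]. destruct L as (b & _ & L & _).
    apply opair_inj in L. tauto. }
  assert (S : forall B, B ∈ setof (fun B => exists n, n ∈ omega /\ B = G n) <->
    exists n, n ∈ omega /\ B = G n).
  { apply (in_setof (power (prod omega A)) (fun B => exists n, n ∈ omega /\ B = G n)).
    - definable. apply DG. definable.
    - intros B (n & Hn & ->). apply in_power. intros p K.
      apply (HG n Hn) in K. destruct K as (a & Ha & -> & _).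
      apply opair_in_prod. tauto. }
  set (F := setof _) in S. clearbody F.
  destruct (AC F) as (f & Hf & C).
  - split.
    + intros (m & Hm & g & Hg & I & _).
      destruct (exists_func omega m (fun n y => y = app g (G n))) as (h & Hh & L).
      * definable. apply DG. definable.
      * intros n Hn. exists (app g (G n)). split; [|intuition congruence].
        split; [|reflexivity]. apply (app_in _ _ _ _ Hg), S. eauto.
      * destruct (no_injection_omega m Hm h Hh)
          as (x & y & Hx & Hy & N & z & P & Q).
        apply N, inj; [assumption..|]. apply I; [apply S; eauto..|].
        apply (func_eq h omega m) in P, Q; [|exact Hh..].
        rewrite <- (L x Hx), <- (L y Hy). intuition congruence.
    + apply (countable_coded F (fun B n => B = G n)).
      * definable. apply DG. definable.
      * intros B K. apply S, K.
      * intros B B' n _ _ -> ->. reflexivity.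
  - intros B K E. apply S in K. destruct K as (n & Hn & ->).
    destruct (H n Hn) as (a & Ha & K). apply (in_empty (opair n a)).
    rewrite <- E. apply (HG n Hn). eauto.
  - destruct (exists_func omega A
      (fun n a => R n a /\ opair n a = app f (G n))) as (s & Hs & K).
    + definable.
      * apply (definable_rel2 R _ _ D); definable.
      * apply DG. definable.
    + intros n Hn.
      assert (K : app f (G n) ∈ G n) by (apply C, S; eauto).
      apply (HG n Hn) in K. destruct K as (a & Ha & E & K).
      exists a. split; [auto|]. intros b (_ & _ & L). rewrite E in L.
      apply opair_inj in L. symmetry. tauto.
    + exists s. split; [exact Hs|]. intros n Hn. apply K, Hn.
Qed.

Lemma CAC_frechet_urysohn X t : CAC V ->
  topology X t -> first_countable X t -> frechet_urysohn X t.
Proof.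
  intros AC T FC A x HA Hx.
  assert (HxX : x ∈ X) by (apply in_closure in Hx; tauto).
  destruct (FC x HxX) as (B & B1 & (C & HC & f & Hf & I & _) & B2 & B3).
  (* The intersection of the basic neighbourhoods of index less than n. *)
  set (N := fun n => setof (fun y => y ∈ X /\
    forall U, U ∈ B -> app f U ∈ n -> y ∈ U)).
  assert (HN : forall n y, y ∈ N n <->
    y ∈ X /\ forall U, U ∈ B -> app f U ∈ n -> y ∈ U).
  { intros n. apply (in_setof X (fun y => y ∈ X /\
      forall U, U ∈ B -> app f U ∈ n -> y ∈ U)); [definable | tauto]. }
  assert (DN : forall a, definable_term a -> definable_term (fun e => N (a e))).
  { intros a. apply (definable_fun1 N). unfold N. definable. }
  assert (open : forall n, n ∈ omega -> N n ∈ t).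
  { apply (omega_ind (fun n => N n ∈ t)).
    - definable. apply DN. definable.
    - replace (N empty) with X; [apply T|]. apply set_ext. intros y.
      rewrite HN. split; [|tauto]. intros K. split; [exact K|].
      intros U _ L. destruct (in_empty _ L).
    - intros n Hn K.
      destruct (classic (exists U, U ∈ B /\ app f U = n)) as [(U & L & M)|L].
      + replace (N (succ n)) with (inter (N n) U);
          [apply T; [exact K | apply B1, L]|].
        apply set_ext. intros y. rewrite in_inter, !HN. split.
        * intros [[P Q] S]. split; [exact P|]. intros W HW O.
          apply in_succ in O. destruct O as [O|O]; [auto|].
          rewrite <- M in O. apply I in O; [|assumption..]. subst W. exact S.
        * intros [P Q]. split; [split|].
          -- exact P.
          -- intros W HW O. apply Q; [exact HW|]. apply in_succ. tauto.
          -- apply Q; [exact L|]. apply in_succ. tauto.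
      + replace (N (succ n)) with (N n); [exact K|].
        apply set_ext. intros y. rewrite !HN. split; intros [P Q].
        * split; [exact P|]. intros W HW O. apply in_succ in O.
          destruct O as [O|O]; [auto|]. exfalso. eauto.
        * split; [exact P|]. intros W HW O. apply Q; [exact HW|].
          apply in_succ. tauto. }
  destruct (CAC_relation A (fun n a => a ∈ N n)) as (s & Hs & K).
  - exact AC.
  - definable. apply DN. definable.
  - intros n Hn. apply (closure_meets X t A x (N n) T HA Hx (open n Hn)).
    apply HN. split; [exact HxX|]. intros U HU _. apply B2, HU.
  - exists s. split; [exact Hs|]. split; [exact HxX|]. intros U HU L.
    destruct (B3 U HU L) as (W & HW & M).
    assert (Hm : app f W ∈ omega) by (apply HC, (app_in _ _ _ _ Hf HW)).
    exists (succ (app f W)). split; [auto with omega|]. intros n Hn O.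
    apply M. apply (HN n (app s n)); [apply K, Hn | exact HW|].
    assert (P : app f W ∈ succ (app f W)) by (apply in_succ; tauto).
    destruct O as [O|<-]; [|exact P]. exact (omega_trans n Hn _ _ P O).
Qed.

(** * Sequential metric spaces give countable choice *)

(** The union of the cuts of a bounded nonempty class of fractions is a cut. *)
Lemma cut_of_bounds u (P : V -> Prop) b :
  (forall q, q ∈ u <-> exists e, P e /\ frac_lt q e) ->
  (exists e, P e /\ e ∈ fracs) -> b ∈ fracs ->
  (forall e, P e -> ~ frac_lt b e) -> cut u.
Proof.
  intros H (e & E1 & E2) Hb B. repeat apply conj.
  - intros q K. apply H in K. destruct K as (e' & _ & K). apply (frac_lt_fracs _ _ K).
  - destruct (frac_below e E2) as [q K]. exists q. apply H. eauto.
  - exists b. split; [exact Hb|]. intros K. apply H in K.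
    destruct K as (e' & K & L). exact (B _ K L).
  - intros p q K L. apply H in K. destruct K as (e' & K & M). apply H.
    exists e'. split; [exact K | exact (frac_lt_trans _ _ _ L M)].
  - intros p K. apply H in K. destruct K as (e' & K & L).
    destruct (frac_dense p e' L) as (q & M & N). exists q. split; [|exact M].
    apply H. eauto.
Qed.

(** For points that are pairs (n, h), where n is called the level: [e] is 0 or,
    when the points are distinct, 1/n for n the positive level of one of them. *)
Definition level_bound x y e : Prop :=
  e = frac_zero \/
  (x <> y /\ exists n h, n ∈ omega /\ e = inv (succ n) /\
    (x = opair (succ n) h \/ y = opair (succ n) h)).

(** The distance of two points, as the supremum of the cuts of their
    [level_bound]s: 0 for equal points, and for distinct points the largest 1/n
    with n a positive level of one of them. *)
Definition level_dist x y : V :=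
  setof (fun q => exists e, level_bound x y e /\ frac_lt q e).

Lemma in_level_dist x y q :
  q ∈ level_dist x y <-> exists e, level_bound x y e /\ frac_lt q e.
Proof.
  apply (in_setof fracs (fun q => exists e, level_bound x y e /\ frac_lt q e)).
  - unfold level_bound, inv. definable.
  - intros p (e & _ & H). apply (frac_lt_fracs _ _ H).
Qed.

Lemma definable_level_dist a b : definable_term a -> definable_term b ->
  definable_term (fun e : nat -> V => level_dist (a e) (b e)).
Proof.
  apply definable_fun2. unfold level_dist, level_bound, inv. definable.
Qed.

Lemma level_dist_cut x y : cut (level_dist x y).
Proof.
  assert (P := inv_pos empty omega_0).
  apply (cut_of_bounds _ (level_bound x y) (inv (succ empty))).
  - apply in_level_dist.
  - exists frac_zero. split; [left; reflexivity | apply frac_zero_fracs].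
  - apply (frac_lt_fracs _ _ P).
  - intros e [->|(_ & n & h & Hn & -> & _)] H.
    + exact (frac_lt_irrefl _ (frac_lt_trans _ _ _ P H)).
    + destruct (omega_cases n Hn) as [->|(k & Hk & ->)].
      * exact (frac_lt_irrefl _ H).
      * apply (frac_lt_irrefl (inv (succ empty))).
        apply (frac_lt_trans _ _ _ H), inv_anti; auto using omega_0, omega_succ.
        apply zero_in_succ, Hk.
Qed.

Lemma level_dist_nonneg x y : real_le real_zero (level_dist x y).
Proof.
  intros q H. rewrite real_zero_below in H. apply in_below in H.
  apply in_level_dist. exists frac_zero. split; [left; reflexivity | exact H].
Qed.

Lemma level_dist_sym x y : level_dist x y = level_dist y x.
Proof.
  assert (H : forall x y e, level_bound x y e -> level_bound y x e).
  { intros a b e [->|(N & n & h & Hn & -> & K)]; [left; reflexivity|].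
    right. split; [auto|]. exists n, h. tauto. }
  apply set_ext. intros q. rewrite !in_level_dist.
  split; intros (e & K & L); eauto.
Qed.

Lemma level_dist_refl x : level_dist x x = real_zero.
Proof.
  apply subset_antisym; [|apply level_dist_nonneg].
  intros q H. apply in_level_dist in H. rewrite real_zero_below.
  destruct H as (e & [->|(N & _)] & H); [apply in_below, H | tauto].
Qed.

Lemma level_dist_pos x y n h : n ∈ omega -> x <> y -> x = opair (succ n) h ->
  level_dist x y <> real_zero.
Proof.
  intros Hn N -> E.
  assert (K : frac_zero ∈ level_dist (opair (succ n) h) y).
  { apply in_level_dist. exists (inv (succ n)). split; [|apply inv_pos, Hn].
    right. split; [exact N|]. exists n, h. tauto. }
  rewrite E, real_zero_below in K. apply in_below in K.
  exact (frac_lt_irrefl _ K).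
Qed.

Lemma level_dist_triangle x y z :
  real_le (level_dist x z) (real_add (level_dist x y) (level_dist y z)).
Proof.
  assert (H : forall e, level_bound x z e -> level_bound x y e \/ level_bound y z e).
  { intros e [->|(N & n & h & Hn & -> & [K|K])]; [left; left; reflexivity|..].
    - destruct (classic (x = y)) as [L|L].
      + right; right. rewrite <- L. split; [exact N|]. exists n, h. tauto.
      + left; right. split; [exact L|]. exists n, h. tauto.
    - destruct (classic (y = z)) as [L|L].
      + left; right. rewrite L. split; [exact N|]. exists n, h. tauto.
      + right; right. split; [exact L|]. exists n, h. tauto. }
  intros q K. apply in_level_dist in K. destruct K as (e & K & L).
  destruct (H e K) as [M|M].
  - apply real_le_add_l; [apply level_dist_cut | apply level_dist_nonneg |].
    apply in_level_dist. eauto.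
  - apply real_le_add_r; [apply level_dist_cut.. | apply level_dist_nonneg |].
    apply in_level_dist. eauto.
Qed.

(** [level_dist] is a metric on every set of pairs in which (0, 0) is the only
    element of level 0.  Two distinct elements have positive distance since one of
    them has a positive level. *)
Lemma level_metric X :
  (forall x, x ∈ X -> x = opair empty empty \/
     exists n h, n ∈ omega /\ x = opair (succ n) h) ->
  exists d, metric X d /\
    forall x y, x ∈ X -> y ∈ X -> dist d x y = level_dist x y.
Proof.
  intros HX.
  destruct (exists_func (prod X X) reals
    (fun p r => exists x y, p = opair x y /\ r = level_dist x y)) as (d & D & K).
  - definable. apply definable_level_dist; definable.
  - intros p H. apply in_prod in H. destruct H as (x & y & _ & _ & ->).
    exists (level_dist x y). split.
    + split; [apply in_reals, level_dist_cut | eauto].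
    + intros r (_ & x' & y' & E & ->). apply opair_inj in E.
      destruct E as [<- <-]. reflexivity.
  - assert (E : forall x y, x ∈ X -> y ∈ X -> dist d x y = level_dist x y).
    { intros x y Hx Hy. destruct (K (opair x y)) as (x' & y' & E & L).
      - apply opair_in_prod. tauto.
      - apply opair_inj in E. destruct E as [<- <-]. exact L. }
    exists d. split; [|exact E]. split; [exact D|]. repeat apply conj.
    + intros x y Hx Hy. rewrite E by assumption. apply level_dist_nonneg.
    + intros x y Hx Hy. rewrite E by assumption.
      split; [|intros ->; apply level_dist_refl].
      intros L. apply NNPP. intros N.
      destruct (HX x Hx) as [Ex|(n & h & Hn & Ex)].
      * destruct (HX y Hy) as [Ey|(n & h & Hn & Ey)]; [congruence|].
        rewrite level_dist_sym in L. revert L.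
        apply (level_dist_pos y x n h); auto.
      * revert L. apply (level_dist_pos x y n h); auto.
    + intros x y Hx Hy. rewrite !E by assumption. apply level_dist_sym.
    + intros x y z Hx Hy Hz. rewrite !E by assumption. apply level_dist_triangle.
Qed.

Lemma S_M_CAC : S_M V -> CAC V.
Proof.
  intros SM F [_ (C & HC & g & Hg & I & _)] NE.
  (* The members of F of index less than n, and the choice functions on them. *)
  set (L := fun n => setof (fun A => A ∈ F /\ app g A ∈ n)).
  assert (HL : forall n A, A ∈ L n <-> A ∈ F /\ app g A ∈ n).
  { intros n. apply (in_setof F (fun A => A ∈ F /\ app g A ∈ n));
      [definable | tauto]. }
  assert (DL : forall a, definable_term a -> definable_term (fun e => L (a e))).
  { intros a. apply (definable_fun1 L). unfold L. definable. }
  set (ch := fun n h => func h (L n) (union F) /\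
    forall A a, opair A a ∈ h -> a ∈ A).
  assert (Dch : definable (fun e => ch (e 0) (e 1))).
  { unfold ch. definable. apply DL. definable. }
  assert (SX : exists X, forall p, p ∈ X <->
    exists n h, n ∈ omega /\ p = opair n h /\ ch n h).
  { eexists. apply (in_setof (prod omega (power (prod F (union F))))
      (fun p => exists n h, n ∈ omega /\ p = opair n h /\ ch n h)).
    - definable. apply (definable_rel2 ch _ _ Dch); definable.
    - intros p (n & h & Hn & -> & [[K _] _]). apply opair_in_prod.
      split; [exact Hn|]. apply in_power. intros q Q. apply K, in_prod in Q.
      destruct Q as (A & a & HA & Ha & ->). apply HL in HA.
      apply opair_in_prod. tauto. }
  destruct SX as [X HX].
  assert (L0 : forall A, A ∉ L empty).
  { intros A H. apply HL in H. exact (in_empty _ (proj2 H)). }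
  assert (ch0 : ch empty empty).
  { split; [split|].
    - intros p H. destruct (in_empty _ H).
    - intros A H. destruct (L0 A H).
    - intros A a H. destruct (in_empty _ H). }
  assert (ch0_unique : forall h, ch empty h -> h = empty).
  { intros h [[H _] _]. apply set_ext. intros p. split; intros K.
    - apply H, in_prod in K. destruct K as (A & _ & K & _). destruct (L0 A K).
    - destruct (in_empty _ K). }
  (* Finite choice, by induction: h is extended by a value a at the member of F
     of index n, if there is one. *)
  assert (ex : forall n, n ∈ omega -> exists h, ch n h).
  { apply (omega_ind (fun n => exists h, ch n h)).
    - definable. apply (definable_rel2 ch _ _ Dch); definable.
    - eauto.
    - intros n Hn (h & Hh & Hc).
      assert (new : exists a, forall A, A ∈ F -> app g A = n -> a ∈ A).
      { destruct (classic (exists A, A ∈ F /\ app g A = n)) as [(A & K & E)|N].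
        - destruct (empty_or_inhabited A) as [M|[a Ha]]; [destruct (NE A K M)|].
          exists a. intros B HB E'. rewrite <- E' in E.
          apply I in E; [|assumption..]. congruence.
        - exists empty. intros A K E. exfalso. eauto. }
      destruct new as [a Ha].
      destruct (exists_func (L (succ n)) (union F) (fun A y =>
        opair A y ∈ h \/ (app g A = n /\ y = a))) as (h' & Hh' & K).
      + definable.
      + intros A HA. apply HL in HA. destruct HA as [HA M].
        apply in_succ in M. destruct M as [M|M].
        * assert (HAn : A ∈ L n) by (apply HL; tauto).
          destruct (func_app h _ _ A Hh HAn) as [P Q].
          exists (app h A). split; [tauto|]. intros y (_ & [Y|[Y _]]).
          -- apply (func_eq h _ _ _ _ Hh Y).
          -- rewrite Y in M. destruct (omega_irrefl n Hn M).
        * exists a. split; [split; [|tauto]|].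
          -- apply in_union. exists A. auto.
          -- intros y (_ & [Y|[_ Y]]); [|auto].
             apply (func_eq h _ _ _ _ Hh) in Y. destruct Y as [Y _].
             apply HL in Y. destruct Y as [_ Y]. rewrite M in Y.
             destruct (omega_irrefl n Hn Y).
      + exists h'. split; [exact Hh'|]. intros A y P.
        apply (func_eq h' _ _ _ _ Hh') in P. destruct P as (HA & _ & <-).
        destruct (K A HA) as [Q|[Q1 Q2]]; [exact (Hc _ _ Q)|].
        rewrite Q2. apply Ha; [|exact Q1]. apply HL in HA. tauto. }
  set (o := opair empty empty : V).
  assert (Xo : o ∈ X) by (apply HX; exists empty, empty; auto using omega_0).
  assert (cases : forall x, x ∈ X -> x = o \/
     exists n h, n ∈ omega /\ x = opair (succ n) h).
  { intros x Hx. apply HX in Hx. destruct Hx as (n & h & Hn & -> & Hc).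
    destruct (omega_cases n Hn) as [->|(k & Hk & ->)]; [left | eauto].
    rewrite (ch0_unique h Hc). reflexivity. }
  destruct (level_metric X cases) as (d & M & E).
  set (t := metric_topology X d).
  set (A := diff X (pair o o)).
  assert (HA : forall x, x ∈ A <-> x ∈ X /\ x <> o).
  { intros x. unfold A. rewrite in_diff, in_pair. tauto. }
  (* Every ball around o contains a point of positive level. *)
  assert (NC : ~ closed X t A).
  { intros [_ H]. apply (in_metric_topology X d _ M) in H.
    destruct (proj2 H o) as (r & R1 & R2 & R3).
    { apply in_diff. rewrite HA. tauto. }
    apply in_reals in R1. destruct (real_pos_witness r R1 R2) as (q & Q & P).
    destruct (frac_archimedean q P) as (n & Hn & K).
    destruct (ex (succ n) (omega_succ n Hn)) as [h Hh].
    set (x := opair (succ n) h).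
    assert (Hx : x ∈ X) by (apply HX; exists (succ n), h; auto using omega_succ).
    assert (Nx : x <> o).
    { intros G. apply opair_inj in G. exact (succ_neq_0 n (proj1 G)). }
    assert (B : subset (level_dist o x) (below (inv (succ n)))).
    { intros p G. apply in_level_dist in G. destruct G as (e & G & G').
      apply in_below. destruct G as [->|(_ & k & h' & Hk & -> & [G|G])].
      - exact (frac_lt_trans _ _ _ G' (inv_pos n Hn)).
      - apply opair_inj in G. destruct (succ_neq_0 k (eq_sym (proj1 G))).
      - apply opair_inj in G. rewrite (proj1 G). exact G'. }
    assert (G : x ∈ diff X A).
    { apply R3. apply (in_ball X d o r x M). split; [exact Hx|].
      rewrite E by assumption. split.
      - intros p G. apply B, in_below in G.
        exact (cut_down _ _ _ R1 Q (frac_lt_trans _ _ _ G K)).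
      - intros G. rewrite <- G in Q. apply B, in_below in Q.
        exact (frac_lt_irrefl _ (frac_lt_trans _ _ _ Q K)). }
    apply in_diff in G. rewrite HA in G. tauto. }
  (* Hence some sequence of points other than o converges to o. *)
  assert (lim : exists s, func s omega A /\ converges X t s o).
  { apply NNPP. intros N. apply NC.
    apply (SM X t (metric_topology_spec X d M)); [exists d; auto|].
    split; [intros x H; apply HA in H; tauto|]. intros s x S Cx.
    apply HA. split; [apply Cx|]. intros ->. eauto. }
  destruct lim as (s & Hs & _ & Cs).
  (* The ball of radius 1/(n + 1) around o only has, apart from o, points of level
     greater than n. *)
  assert (high : forall n, n ∈ omega -> exists k j h, k ∈ omega /\ j ∈ omega /\
    n ∈ j /\ ch j h /\ opair k (opair j h) ∈ s).
  { intros n Hn. assert (P := inv_pos n Hn).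
    set (U := ball X d o (below (inv (succ n)))).
    assert (R : below (inv (succ n)) ∈ reals)
      by apply in_reals, below_cut, (frac_lt_fracs _ _ P).
    destruct (Cs U) as (m & Hm & K).
    - apply ball_open; assumption.
    - apply ball_center; [assumption..|]. apply zero_lt_below, P.
    - specialize (K m Hm (or_intror eq_refl)).
      destruct (func_app s _ _ m Hs Hm) as [S1 S2].
      apply HA in S2. destruct S2 as [S2 S3].
      apply (in_ball X d o _ _ M) in K. destruct K as [_ [K _]].
      rewrite E in K by assumption.
      destruct (cases _ S2) as [G|(j & h & Hj & G)]; [contradiction|].
      rewrite G in *. apply HX in S2. destruct S2 as (j' & h' & _ & G' & S2).
      apply opair_inj in G'. destruct G' as [<- <-].
      exists m, (succ j), h. split; [exact Hm|]. split; [auto with omega|].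
      split; [|split; [exact S2 | exact S1]].
      destruct (omega_trichotomy n j Hn Hj) as [Q|[Q|Q]];
        [apply in_succ; tauto.. |]. exfalso.
      apply (frac_lt_irrefl (inv (succ n))), in_below, K, in_level_dist.
      exists (inv (succ j)). split; [|apply inv_anti; assumption].
      right. split; [auto|]. exists j, h. auto. }
  (* The value at B is that of the first choice function of the sequence
     defined at B. *)
  set (Q := fun B a k => exists j h, opair k (opair j h) ∈ s /\ opair B a ∈ h).
  assert (DQ : definable (fun e => Q (e 0) (e 1) (e 2))) by (unfold Q; definable).
  assert (Qch : forall B a k, Q B a k -> a ∈ B /\ exists j h,
    ch j h /\ app s k = opair j h /\ app h B = a).
  { intros B a k (j & h & H & K). apply (func_eq s _ _ _ _ Hs) in H.
    destruct H as (_ & H & H'). apply HA in H. destruct H as [H _].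
    apply HX in H. destruct H as (j' & h' & _ & G & H).
    apply opair_inj in G. destruct G as [<- <-]. split; [apply (proj2 H _ _ K)|].
    exists j, h. split; [exact H|]. split; [exact H'|].
    apply (func_eq h _ _ _ _ (proj1 H) K). }
  destruct (exists_func F (union F) (fun B a => exists k, k ∈ omega /\ Q B a k /\
    forall k', k' ∈ k -> ~ exists a', Q B a' k')) as (f & Hf & K).
  - definable; apply (definable_rel3 Q _ _ _ DQ); definable.
  - intros B HB.
    assert (HgB : app g B ∈ omega) by (apply HC, (app_in _ _ _ _ Hg HB)).
    destruct (omega_least (fun k => exists a, Q B a k)) as (k & Hk & (a & Ha) & K).
    + definable. apply (definable_rel3 Q _ _ _ DQ); definable.
    + destruct (high _ HgB) as (k & j & h & Hk & Hj & H1 & H2 & H3).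
      exists k. split; [exact Hk|]. exists (app h B), j, h. split; [exact H3|].
      apply (func_app h _ _ B (proj1 H2)), HL. tauto.
    + exists a. split.
      * split; [|eauto]. apply in_union. exists B. split; [exact HB|].
        apply (Qch _ _ _ Ha).
      * intros b (_ & k' & Hk' & Hb & K').
        assert (G : k = k')
          by exact (least_unique (fun k => exists a, Q B a k) k k' Hk Hk'
               (ex_intro _ a Ha) K (ex_intro _ b Hb) K').
        subst k'. apply Qch in Ha, Hb.
        destruct Ha as (_ & j & h & _ & G1 & <-),
          Hb as (_ & j' & h' & _ & G2 & <-).
        rewrite G1 in G2. apply opair_inj in G2. destruct G2 as [_ <-].
        reflexivity.
  - exists f. split; [exact Hf|]. intros B HB.
    destruct (K B HB) as (k & _ & G & _). apply (Qch _ _ _ G).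
Qed.

End Models.

Theorem theorem6p12 (V : ZF) :
  (CAC V <-> FU_M V) /\
  (CAC V <-> S_M V) /\
  (CAC V <-> HS_M V) /\
  (CAC V <-> first_countable_hausdorff_FU V) /\
  (CAC V <-> first_countable_hausdorff_S V) /\
  (CAC V <-> first_countable_hausdorff_HS V).
Proof.
  assert (H0 : CAC V -> first_countable_hausdorff_FU V).
  { intros AC X t T H _. apply CAC_frechet_urysohn; assumption. }
  assert (H1 : first_countable_hausdorff_FU V -> first_countable_hausdorff_HS V).
  { intros H X t T K L. apply frechet_urysohn_hereditarily_sequential; auto. }
  assert (H2 : first_countable_hausdorff_HS V -> first_countable_hausdorff_S V).
  { intros H X t T K L. apply hereditarily_sequential_sequential; auto. }
  assert (H3 : first_countable_hausdorff_S V -> S_M V).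
  { intros H X t T K.
    auto using metrizable_first_countable, metrizable_hausdorff. }
  assert (H4 : first_countable_hausdorff_FU V -> FU_M V).
  { intros H X t T K.
    auto using metrizable_first_countable, metrizable_hausdorff. }
  assert (H5 : FU_M V -> HS_M V).
  { intros H X t T K. apply frechet_urysohn_hereditarily_sequential; auto. }
  assert (H6 : HS_M V -> S_M V).
  { intros H X t T K. apply hereditarily_sequential_sequential; [exact T|].
    exact (H X t T K). }
  assert (H7 : S_M V -> CAC V) by apply S_M_CAC.
  tauto.
Qed.
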